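(* Let $\Phi$ be an irreducible root system of rank $\ell$ with a fixed simple system $\Delta=\{\alpha_1,\dots,\alpha_\ell\}$ and set of positive roots $\Phi^+$. For every ideal $I\subseteq\Phi^+$, the ideal subarrangement $\mathcal{A}(I)=\{H_\alpha\mid \alpha\in I\}$ is a free arrangement, and its multiset of exponents is $\mathcal{DP}(I)$, the dual partition of the height distribution in $I$.
   Context: $\Phi$ is a finite reduced crystallographic root system (that is, the root system of a finite Weyl group) spanning the $\ell$-dimensional real Euclidean space $V$. The partial order on $\Phi^+$ is: $\alpha\ge\beta$ if $\alpha-\beta\in\mathbb{Z}_{\ge0}\alpha_1+\cdots+\mathbb{Z}_{\ge0}\alpha_\ell$. A subset $I\subseteq\Phi^+$ is an ideal if every $\beta\in\Phi^+$ with $\alpha\ge\beta$ for some $\alpha\in I$ belongs to $I$. The height of $\alpha=\sum_{i=1}^\ell c_i\alpha_i\in\Phi^+$ is $\mathrm{ht}(\alpha)=\sum_{i=1}^\ell c_i$. $H_\alpha\subset V$ is the hyperplane orthogonal to $\alpha$. Height distribution and dual partition: let $m=\max\{\mathrm{ht}(\alpha)\mid\alpha\in I\}$ and $i_j=|\{\alpha\in I\mid \mathrm{ht}(\alpha)=j\}|$ for $1\le j\le m$. The height distribution in $I$ is $(i_1,\dots,i_m)$, and its dual partition is the multiset of $\ell$ integers $$\mathcal{DP}(I)=\big((0)^{\ell-i_1},(1)^{i_1-i_2},\dots,(m-1)^{i_{m-1}-i_m},(m)^{i_m}\big),$$ where $(a)^b$ means that the integer $a$ appears exactly $b$ times. That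 the multiplicities are nonnegative (i.e. $\ell\ge i_1\ge i_2\ge\cdots\ge i_m$) is understood as part of what is asserted. For $I=\emptyset$ use $m=0$ and $\mathcal{DP}(\emptyset)=((0)^\ell)$. Free arrangements: an arrangement $\mathcal{A}$ in an $\ell$-dimensional vector space $V$ over a field $k$ is a finite set of linear hyperplanes. Let $S=S(V^* )$ be the symmetric algebra of $V^*$, let $\mathrm{Der}\,S$ be the module of $k$-linear derivations $S\to S$, and let $\alpha_H\in V^*$ be a defining linear form of $H\in\mathcal{A}$. Put $D(\mathcal{A})=\{\theta\in\mathrm{Der}\,S\mid \theta(\alpha_H)\in\alpha_HS\text{ for all }H\in\mathcal{A}\}$. $\mathcal{A}$ is free with exponents $(d_1,\dots,d_\ell)$ (regarded as a multiset) if $D(\mathcal{A})$ is a free $S$-module with a homogeneous basis $\theta_1,\dots,\theta_\ell$ such that $\deg\theta_i=d_i$. Here $\theta$ is homogeneous of degree $d$ if $\theta(x)$ is homogeneous of polynomial degree $d$ (or zero) for every $x\in V^*$. *)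

(* Defs.v *)
From HB Require Import structures.
From mathcomp Require Import all_boot all_order all_algebra.
From mathcomp Require Import finmap.
From mathcomp Require Import reals.
From mathcomp Require Import mpoly.

Set Implicit Arguments.
Unset Strict Implicit.
Unset Printing Implicit Defensive.

Import Order.TTheory GRing.Theory Num.Theory.

Local Open Scope fset_scope.
Local Open Scope ring_scope.

(* The l-dimensional Euclidean space V is 'rV[R]_l with its
   standard inner product. *)

Section RootSystems.
Variables (R : realType) (l : nat).
Implicit Types (a b v : 'rV[R]_l) (Phi I : {fset 'rV[R]_l}).
Implicit Types (Delta : l.-tuple 'rV[R]_l).

Definition dot a b : R := \sum_(i < l) a 0 i * b 0 i.

(* The Cartan number <b, a^vee>. *)
Definition cartan b a : R := 2 * dot b a / dot a a.

Definition reflection a b : 'rV[R]_l := b - cartan b a *: a.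

Record root_system Phi : Prop := RootSystem {
  root_neq0 : 0 \notin Phi;
  root_span : <<enum_fset Phi>>%VS = fullv;
  root_refl : {in Phi &, forall a b, reflection a b \in Phi};
  root_crystallographic : {in Phi &, forall a b, cartan b a \is a Num.int};
  root_reduced : {in Phi, forall a (c : R), c *: a \in Phi -> c = 1 \/ c = -1}
}.

Definition irreducible_roots Phi : Prop :=
  Phi <> fset0 /\
  forall Psi : {fset 'rV[R]_l}, Psi `<=` Phi ->
    {in Psi & Phi `\` Psi, forall a b, dot a b = 0} ->
    Psi = fset0 \/ Psi = Phi.

(* v lies in Z_{>=0} alpha_1 + ... + Z_{>=0} alpha_l; this reading of the
   coordinates is meaningful because Delta is always assumed to be a basis. *)
Definition nat_comb Delta v : bool :=
  [forall i : 'I_l, coord Delta i v \is a Num.nat].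

Record simple_system Phi Delta : Prop := SimpleSystem {
  simple_basis : basis_of fullv Delta;
  simple_root : {subset Delta <= Phi};
  simple_sign : {in Phi, forall b, nat_comb Delta b \/ nat_comb Delta (- b)}
}.

Definition pos_roots Phi Delta : {fset 'rV[R]_l} :=
  [fset b in Phi | nat_comb Delta b].

Definition root_ge Delta a b : bool := nat_comb Delta (a - b).

Definition root_ideal Phi Delta I : Prop :=
  I `<=` pos_roots Phi Delta /\
  {in I & pos_roots Phi Delta, forall a b, root_ge Delta a b -> b \in I}.

(* The sum of the coordinates of a positive root is a natural number in R, so
   the truncation to nat is exact there. *)
Definition height Delta a : nat :=
  Num.truncn (\sum_(i < l) coord Delta i a).

Definition max_height Delta I : nat := (\max_(a <- I) height Delta a)%N.

Definition height_count Delta I (j : nat) : nat :=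
  #|` [fset a in I | height Delta a == j]|.

(* l >= i_1 >= i_2 >= ... >= i_m, which makes the truncated differences in
   dual_partition genuine. *)
Definition height_count_nonincreasing Delta I : Prop :=
  (height_count Delta I 1 <= l)%N /\
  forall j : nat, (0 < j < max_height Delta I)%N ->
    (height_count Delta I j.+1 <= height_count Delta I j)%N.

(* The multiset DP(I), as a sequence to be read up to permutation; since
   i_(m+1) = 0, the last block is nseq i_m m. *)
Definition dual_partition Delta I : seq nat :=
  nseq (l - height_count Delta I 1) 0%N ++
  flatten [seq nseq (height_count Delta I j - height_count Delta I j.+1) j
          | j <- iota 1 (max_height Delta I)].

Definition root_hyperplane a : {vspace 'rV[R]_l} :=
  lker (linfun (fun v => dot a v : R^o)).

Definition ideal_arrangement I : {fset {vspace 'rV[R]_l}} :=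
  [fset root_hyperplane a | a in I].

Fact dot_is_linear a : linear (fun v => dot a v : R^o).
Proof.
move=> c u v; rewrite /dot scaler_sumr -big_split /=; apply: eq_bigr => i _.
by rewrite !mxE mulrDr -[c *: _]/(c * _) mulrCA.
Qed.

Lemma mem_root_hyperplane a v : (v \in root_hyperplane a) = (dot a v == 0).
Proof.
pose f : {linear 'rV[R]_l -> R^o} := HB.pack (fun v => dot a v : R^o)
  (GRing.isLinear.Build _ _ _ _ _ (dot_is_linear a)).
by rewrite memv_ker (lfunE f).
Qed.

End RootSystems.

Section FreeArrangements.
Variables (K : fieldType) (l : nat).
Implicit Types (A : {fset {vspace 'rV[K]_l}}) (H : {vspace 'rV[K]_l}).

(* S(V^* ) for V = K^l is identified with {mpoly K[l]}, 'X_i being the i-th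
   coordinate function; V^* is then the space of 1-homogeneous polynomials. *)
Local Notation S := {mpoly K[l]}.

Definition is_arrangement A : Prop :=
  {in A, forall H, (\dim H).+1 = l}.

Definition defining_form H (f : S) : Prop :=
  f \is 1.-homog /\ forall v : 'rV[K]_l, (v \in H) = (f.@[v 0] == 0).

Definition derivation (theta : S -> S) : Prop :=
  linear theta /\
  forall f g : S, theta (f * g) = theta f * g + f * theta g.

(* The module D(A); the condition at H does not depend on the choice of the
   defining form, which is unique up to a nonzero scalar. *)
Definition log_derivation A (theta : S -> S) : Prop :=
  derivation theta /\
  {in A, forall H (f : S), defining_form H f ->
    exists g : S, theta f = f * g}.

Definition homogeneous_derivation (d : nat) (theta : S -> S) : Prop :=
  forall x : S, x \is 1.-homog -> theta x \is d.-homog.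

Definition log_basis A (theta : 'I_l -> S -> S) : Prop :=
  [/\ forall i, log_derivation A (theta i),
      forall eta, log_derivation A eta ->
        exists p : 'I_l -> S, forall f, eta f = \sum_(i < l) p i * theta i f
    & forall p : 'I_l -> S,
        (forall f, \sum_(i < l) p i * theta i f = 0) -> forall i, p i = 0].

Definition free_with_exponents A (d : seq nat) : Prop :=
  exists (theta : 'I_l -> S -> S) (e : l.-tuple nat),
    [/\ log_basis A theta,
        forall i, homogeneous_derivation (tnth e i) (theta i)
      & perm_eq e d].

End FreeArrangements.

(* Main.v *)
Require Import Defs.
From HB Require Import structures.
From mathcomp Require Import all_boot all_order all_algebra.
From mathcomp Require Import finmap.
From mathcomp Require Import reals.
From mathcomp Require Import mpoly.
From mathcomp Require Import ring lra.

(** The hyperplanes are added by increasing height of the roots, keeping a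
   homogeneous basis of the tangent derivations all along.

   Suppose that the roots of I of height at most k have a basis with exponents
   at most k, and let B be the set of roots of I of height k + 1. The main step
   (multiple_addition) says that adding B turns as many exponents k into k + 1 as B
   has elements; so the exponents that are at least j number i_j for every j,
   which is the dual partition and makes the sequence (i_j) nonincreasing. This
   step rests on three facts.

   - For b in B and a derivation theta tangent to the roots A of height at most k,
     theta(b) lies in the ideal generated by b and by a polynomial restr b A, a product
     of linear forms that gathers, for each plane P through b, one factor less
     than there are elements of A in P (tangent_restr).

   - The degree of restr b A is at least k (height_le_restr_deg). Indeed the
     height of b is its pairing with the half-sum of all positive coroots,
     so that ht(b) - 1 splits over the planes P through b; the part of P is ht_P(b) - 1
     for the height of b in the rank-two root system of P, and b is above at least
     ht_P(b) roots of P unless it is simple there. Equality follows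
     from the existence, below, of a field of degree at most k whose
     coefficient on restr b A is nonzero.

   - B is linearly independent, and its span contains no positive root of smaller
     height (no_low_root_in_span). Hence some point x lies on all the
     hyperplanes of B and on none of those of A; at x the basis fields
     span all tangent vectors, which yields, for each b in turn, a
     field of degree k whose value on b is restr b A times a nonzero constant,
     modulo b. Multiplying this field by b and clearing the others with it gives
     the new basis; it generates because linear forms are prime (addition). *)

Set Implicit Arguments.
Unset Strict Implicit.
Unset Printing Implicit Defensive.

Import Order.TTheory GRing.Theory Num.Theory.
Local Open Scope ring_scope.

(** * The scalar product *)

Section Dot.
Variables (R : realType) (l : nat).
Implicit Types (a b u v : 'rV[R]_l).

Lemma dotC a b : dot a b = dot b a.
Proof. by apply: eq_bigr => i _; rewrite mulrC. Qed.

Lemma dotDr a u v : dot a (u + v) = dot a u + dot a v.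
Proof. by rewrite /dot -big_split; apply: eq_bigr => i _; rewrite mxE mulrDr. Qed.

Lemma dotZr a c v : dot a (c *: v) = c * dot a v.
Proof. by rewrite /dot mulr_sumr; apply: eq_bigr => i _; rewrite mxE mulrCA. Qed.

Lemma dotNr a v : dot a (- v) = - dot a v.
Proof. by rewrite -scaleN1r dotZr mulN1r. Qed.

Lemma dotBr a u v : dot a (u - v) = dot a u - dot a v.
Proof. by rewrite dotDr dotNr. Qed.

Lemma dot0r a : dot a 0 = 0.
Proof. by rewrite -(scale0r 0) dotZr mul0r. Qed.

Lemma dotDl a u v : dot (u + v) a = dot u a + dot v a.
Proof. by rewrite ![dot _ a]dotC dotDr. Qed.

Lemma dotZl a c v : dot (c *: v) a = c * dot v a.
Proof. by rewrite ![dot _ a]dotC dotZr. Qed.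

Lemma dotNl a v : dot (- v) a = - dot v a.
Proof. by rewrite ![dot _ a]dotC dotNr. Qed.

Lemma dotBl a u v : dot (u - v) a = dot u a - dot v a.
Proof. by rewrite dotDl dotNl. Qed.

Lemma dot0l a : dot 0 a = 0.
Proof. by rewrite dotC dot0r. Qed.

Lemma dot_sumr a (T : Type) (s : seq T) (P : pred T) (F : T -> 'rV[R]_l) :
  dot a (\sum_(t <- s | P t) F t) = \sum_(t <- s | P t) dot a (F t).
Proof. exact: (big_morph _ (dotDr a) (dot0r a)). Qed.

Lemma dot_suml a (T : Type) (s : seq T) (P : pred T) (F : T -> 'rV[R]_l) :
  dot (\sum_(t <- s | P t) F t) a = \sum_(t <- s | P t) dot (F t) a.
Proof. by rewrite dotC dot_sumr; apply: eq_bigr => t _; rewrite dotC. Qed.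

Lemma dot_ge0 a : 0 <= dot a a.
Proof. by apply: sumr_ge0 => i _; rewrite -expr2 sqr_ge0. Qed.

Lemma dot_eq0 a : (dot a a == 0) = (a == 0).
Proof.
apply/eqP/eqP => [/eqP|->]; last exact: dot0r.
rewrite psumr_eq0 => [/allP a0|i _]; last by rewrite -expr2 sqr_ge0.
apply/rowP => i; rewrite mxE; apply/eqP.
by have := a0 i (mem_index_enum _); rewrite -expr2 sqrf_eq0.
Qed.

Lemma dot_gt0 a : (0 < dot a a) = (a != 0).
Proof. by rewrite lt0r dot_ge0 andbT dot_eq0. Qed.

Definition proj_perp b a := a - (dot a b / dot b b) *: b.

Lemma dot_proj_perp b a v : dot b v = 0 -> dot (proj_perp b a) v = dot a v.
Proof. by move=> bv; rewrite dotBl dotZl bv mulr0 subr0. Qed.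

Lemma proj_perp_id b : b != 0 -> proj_perp b b = 0.
Proof. by rewrite -dot_eq0 => b0; rewrite /proj_perp divff // scale1r subrr. Qed.

Lemma proj_perpD b u v : proj_perp b (u + v) = proj_perp b u + proj_perp b v.
Proof. by rewrite /proj_perp dotDl mulrDl scalerDl opprD addrACA. Qed.

Lemma proj_perpZ b c v : proj_perp b (c *: v) = c *: proj_perp b v.
Proof. by rewrite /proj_perp dotZl scalerBr scalerA mulrA. Qed.

Lemma proj_perp_line b u v c :
  proj_perp b u = c *: proj_perp b v -> exists d, u = c *: v + d *: b.
Proof.
rewrite /proj_perp scalerBr => /(canRL (subrK _)) ->.
exists (dot u b / dot b b - c * (dot v b / dot b b)).
by rewrite scalerBl -!scalerA; rewrite -addrA (addrC (- _)).
Qed.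

End Dot.

(** * Linear forms as prime elements of the polynomial ring *)

Section LinearForms.
Variables (R : realType) (l : nat).
Implicit Types (a b u v : 'rV[R]_l) (p q : {mpoly R[l]}).
Local Notation S := {mpoly R[l]}.

Definition lform a : S := \sum_(i < l) a 0 i *: 'X_i.

Fact lform_is_linear : linear lform.
Proof.
move=> c u v; rewrite /lform scaler_sumr -big_split /=; apply: eq_bigr => i _.
by rewrite !mxE scalerDl scalerA.
Qed.
HB.instance Definition _ := GRing.isLinear.Build R _ _ _ lform lform_is_linear.

Lemma lform_homog a : lform a \is 1.-homog.
Proof.
by apply: rpred_sum => i _; apply: dhomogZ; rewrite dhomogX /= mdeg1.
Qed.

Lemma meval_lform a v : (lform a).@[v 0] = dot a v.
Proof.
rewrite /lform raddf_sum; apply: eq_bigr => i _.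
by rewrite /= mevalZ mevalXU.
Qed.

Lemma lform_eq0 a : (lform a == 0) = (a == 0).
Proof.
apply/eqP/eqP => [a0|->]; last exact: linear0.
by apply/eqP; rewrite -dot_eq0 -meval_lform a0 meval0.
Qed.

Lemma homog1_lform p : p \is 1.-homog -> p = lform (\row_i p@_U_(i)).
Proof.
move=> hp; apply/mpolyP => m; rewrite /lform raddf_sum /=.
under eq_bigr do rewrite mcoeffZ mxE mcoeffX.
have [m1|m1] := eqVneq (mdeg m) 1%N; last first.
  rewrite (dhomog_nemf_coeff hp m1) big1 // => i _.
  case: (_ =P m) => [im|_]; last by rewrite mulr0.
  by move: m1; rewrite -im mdeg1 eqxx.
have /mdeg1P [i0 /eqP ->] : mdeg m == 1%N by rewrite m1.
rewrite (bigD1 i0) //= eqxx mulr1 big1 ?addr0 // => i ni.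
by rewrite eq_mnm1 (negPf ni) mulr0.
Qed.

Definition mdvd p q := exists g, q = p * g.

Lemma mdvd_mulr p q g : mdvd p q -> mdvd p (q * g).
Proof. by case=> h ->; exists (h * g); rewrite mulrA. Qed.

Lemma mdvd_mull p q g : mdvd p q -> mdvd p (g * q).
Proof. by rewrite mulrC; exact: mdvd_mulr. Qed.

Lemma mdvdD p q1 q2 : mdvd p q1 -> mdvd p q2 -> mdvd p (q1 + q2).
Proof. by case=> g -> [h ->]; exists (g + h); rewrite mulrDr. Qed.

Lemma mdvdN p q : mdvd p q -> mdvd p (- q).
Proof. by case=> g ->; exists (- g); rewrite mulrN. Qed.

Lemma mdvdB p q1 q2 : mdvd p q1 -> mdvd p q2 -> mdvd p (q1 - q2).
Proof. by move=> h1 h2; apply: mdvdD => //; apply: mdvdN. Qed.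

Lemma mdvd_sum p (T : Type) (s : seq T) (F : T -> S) :
  (forall t, mdvd p (F t)) -> mdvd p (\sum_(t <- s) F t).
Proof.
move=> h; elim/big_rec: _ => [|t q _ hq]; first by exists 0; rewrite mulr0.
exact: mdvdD.
Qed.

(** The substitution that restricts polynomials to the hyperplane orthogonal
   to b, viewing the restriction as a polynomial pulled back along the
   orthogonal projection; it is a ring morphism with kernel (lform b), which is how
   lform b is seen to be prime. *)
Definition flat b p : S :=
  p \mPo [tuple lform (proj_perp b (delta_mx 0 i)) | i < l].

Lemma flatM b : {morph flat b : p q / p * q}.
Proof. by move=> p q; rewrite /flat rmorphM. Qed.

Lemma flat_lform b a : flat b (lform a) = lform (proj_perp b a).
Proof.
rewrite /flat {1}/lform raddf_sum /=.
transitivity (\sum_i lform (proj_perp b (a 0 i *: delta_mx 0 i))).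
  apply: eq_bigr => i _.
  by rewrite comp_mpolyZ comp_mpolyXU -tnth_nth tnth_mktuple proj_perpZ linearZ.
have p0 : proj_perp b 0 = 0 by rewrite /proj_perp dot0l mul0r scale0r subr0.
by rewrite -raddf_sum /= -(big_morph _ (proj_perpD b) p0) -row_sum_delta.
Qed.

Lemma flat_lform0 b : b != 0 -> flat b (lform b) = 0.
Proof. by move=> b0; rewrite flat_lform proj_perp_id // linear0. Qed.

Lemma flatP b p : mdvd (lform b) (p - flat b p).
Proof.
have mulP q1 q2 : mdvd (lform b) (q1 - flat b q1) -> mdvd (lform b) (q2 - flat b q2) ->
    mdvd (lform b) (q1 * q2 - flat b (q1 * q2)).
  move=> h1 h2; rewrite flatM.
  have -> : q1 * q2 - flat b q1 * flat b q2
     = (q1 - flat b q1) * q2 + flat b q1 * (q2 - flat b q2) by ring.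
  by apply: mdvdD; [apply: mdvd_mulr|apply: mdvd_mull].
elim/mpolyind: p => [|c m p _ _ IHp].
  by rewrite /flat raddf0 subrr; exists 0; rewrite mulr0.
rewrite /flat raddfD opprD addrACA; apply: mdvdD => //.
rewrite /= comp_mpolyZ -scalerBr -mul_mpolyC; apply: mdvd_mull.
rewrite -/(flat b _) mpolyXE_id.
have one : mdvd (lform b) (1 - flat b 1).
  by rewrite /flat comp_mpoly1 subrr; exists 0; rewrite mulr0.
elim/big_rec: _ => // i q _ hq; apply: (mulP _ _) => //.
have powP q1 n : mdvd (lform b) (q1 - flat b q1) ->
    mdvd (lform b) (q1 ^+ n - flat b (q1 ^+ n)).
  by move=> h1; elim: n => [|n IHn] //; rewrite exprS; apply: (mulP _ _).
apply: powP; rewrite /flat comp_mpolyXU -tnth_nth tnth_mktuple.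
have {1}-> : 'X_i = lform (delta_mx 0 i).
  rewrite /lform (bigD1 i) //= mxE !eqxx scale1r big1 ?addr0 // => j nj.
  by rewrite mxE (negPf nj) andbF scale0r.
rewrite -linearB /proj_perp opprB addrC subrK linearZ /= -mul_mpolyC.
by exists (dot (delta_mx 0 i) b / dot b b)%:MP; rewrite mulrC.
Qed.

Lemma lform_dvdE b p : b != 0 -> mdvd (lform b) p <-> flat b p = 0.
Proof.
move=> b0; split=> [[g ->]|p0]; first by rewrite flatM flat_lform0 // mul0r.
by have := flatP b p; rewrite p0 subr0.
Qed.

Lemma lform_prime b p q : b != 0 ->
  mdvd (lform b) (p * q) -> mdvd (lform b) p \/ mdvd (lform b) q.
Proof.
move=> b0; rewrite !lform_dvdE // flatM => /eqP.
by rewrite mulf_eq0 => /orP [] /eqP; [left|right].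
Qed.

Lemma lform_dvd_lform b a : b != 0 ->
  mdvd (lform b) (lform a) -> exists c, a = c *: b.
Proof.
move=> b0 /(lform_dvdE _ b0) /eqP; rewrite flat_lform lform_eq0 subr_eq0 => /eqP ->.
by eexists.
Qed.

(** Gauss's lemma for a power of the prime lform b, by cancelling one factor
   at a time. *)
Lemma lform_Gauss b n w p : b != 0 -> ~ mdvd (lform b) w ->
  mdvd (lform b ^+ n) (w * p) -> mdvd (lform b ^+ n) p.
Proof.
move=> b0 bw; elim: n p => [|n IHn] p [g e]; first by exists p; rewrite mul1r.
have [//|[p' ep]] : mdvd (lform b) w \/ mdvd (lform b) p.
  by apply: lform_prime => //; rewrite e exprS -mulrA; eexists.
have [h eh] : mdvd (lform b ^+ n) p'.
  apply: IHn; exists g; apply: (@mulfI _ (lform b)); first by rewrite lform_eq0.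
  by rewrite [RHS]mulrA -exprS -e ep mulrCA.
by exists h; rewrite ep eh exprS mulrA.
Qed.

Lemma prod_lform_dvd (T : eqType) (s : seq T) (u : T -> 'rV[R]_l) (n : T -> nat) p :
    uniq s -> {in s, forall t, u t != 0} ->
    {in s &, forall t t' c, u t = c *: u t' -> t = t'} ->
    {in s, forall t, mdvd (lform (u t) ^+ n t) p} ->
  mdvd (\prod_(t <- s) lform (u t) ^+ n t) p.
Proof.
elim: s => [|t s IHs] /= s_uniq u0 uu dv; first by exists p; rewrite big_nil mul1r.
have [tNs {}s_uniq] := andP s_uniq.
have sub x : x \in s -> x \in t :: s by rewrite inE orbC => ->.
have [|x y xs ys||g eg] := IHs s_uniq.
- by move=> x xs; apply/u0/sub.
- by apply: uu; apply: sub.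
- by move=> x xs; apply/dv/sub.
have [h eh] : mdvd (lform (u t) ^+ n t) g.
  have tt : t \in t :: s by rewrite mem_head.
  apply: (@lform_Gauss _ _ (\prod_(x <- s) lform (u x) ^+ n x));
    [exact: u0| |by rewrite -eg; apply: dv].
  have : {subset s <= s} by [].
  elim: {-2}s => [|x s' IHs' s's]; first rewrite big_nil => _.
    move=> /(lform_dvdE _ (u0 _ tt)); rewrite /flat comp_mpoly1 => /eqP.
    by rewrite oner_eq0.
  rewrite big_cons => /(lform_prime (u0 _ tt)) []; last first.
    by apply: IHs' => y ys; apply: s's; rewrite inE ys orbT.
  have xs : x \in s by rewrite s's ?mem_head.
  elim: (n x) => [|m IHm].
    rewrite expr0 => /(lform_dvdE _ (u0 _ tt)); rewrite /flat comp_mpoly1 => /eqP.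
    by rewrite oner_eq0.
  rewrite exprS => /(lform_prime (u0 _ tt)) [|//].
  move=> /(lform_dvd_lform (u0 _ tt)) [c ec].
  by case/negP: tNs; rewrite -(uu x t (sub _ xs) tt c ec).
by exists h; rewrite big_cons -mulrA mulrCA -eh.
Qed.

Lemma flat_homog b p d : p \is d.-homog -> flat b p \is d.-homog.
Proof.
move=> hp; rewrite /flat comp_mpolyE big_seq; apply: rpred_sum => m mp.
rewrite rpredZ // -(dhomog_mf hp mp) /= mdegE.
elim/big_rec2: _ => [|i e q _ hq]; first exact: dhomog1.
apply: dhomogM => //; rewrite tnth_mktuple.
by have := dhomogMn (m i) (lform_homog (proj_perp b (delta_mx 0 i))); rewrite mul1n.
Qed.

(** A homogeneous multiple of a homogeneous polynomial has a homogeneous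
   cofactor: take the component of the right degree. *)
Lemma homog_cofactor p g e d : p \is d.-homog -> p * g \is e.-homog ->
  exists g', [/\ p * g = p * g', (e < d)%N -> g' = 0
               & (d <= e)%N -> g' \is (e - d).-homog].
Proof.
move=> hp hpg.
have comp : p * g = if (d <= e)%N then p * pihomog mdeg (e - d) g else 0.
  rewrite -{1}(pihomog_dE hpg).
  rewrite {1}(pihomog_partitionE (leq_maxl (mmeasure mdeg g) (e - d).+1)).
  rewrite mulr_sumr raddf_sum /=.
  have comp1 i : pihomog mdeg e (p * pihomog mdeg i g)
               = if (d + i == e)%N then p * pihomog mdeg i g else 0.
    have h := dhomogM hp (pihomogP mdeg i g).
    case: eqP => [<-|/eqP ne]; first exact: pihomog_dE.
    exact: pihomog_ne0 h.
  under eq_bigr do rewrite comp1.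
  case: leqP => de; last first.
    rewrite big1 // => i _; case: eqP => // edi.
    by have := leq_addr i d; rewrite edi leqNgt de.
  rewrite (bigD1 (Ordinal (leq_maxr (mmeasure mdeg g) (e - d).+1))) //=.
  rewrite subnKC // eqxx big1 ?addr0 // => i ni.
  case: eqP => // edi; case/eqP: ni; apply/val_inj.
  by have := addKn d i; rewrite edi => /esym.
exists (if (d <= e)%N then pihomog mdeg (e - d) g else 0); split.
- by rewrite comp; case: ifP => // _; rewrite mulr0.
- by rewrite ltnNge => /negPf ->.
- by move=> ->; apply: pihomogP.
Qed.

End LinearForms.

(** * Tangent fields and restriction to a hyperplane *)

Section VectorFields.
Variables (R : realType) (l : nat).
Implicit Types (a b u v x : 'rV[R]_l) (A : seq 'rV[R]_l).
Local Notation S := {mpoly R[l]}.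
Implicit Types (w : 'rV[S]_l) (p : S).

(** The value at lform a of the derivation whose coefficient vector is w. *)
Definition along w a : S := \sum_(i < l) a 0 i *: w 0 i.

Lemma alongP w c u v : along w (c *: u + v) = c *: along w u + along w v.
Proof.
rewrite /along scaler_sumr -big_split /=; apply: eq_bigr => i _.
by rewrite !mxE scalerDl scalerA.
Qed.

Lemma along0r w : along w 0 = 0.
Proof. by rewrite /along big1 // => i _; rewrite mxE scale0r. Qed.

Lemma along_linear p w1 w2 a :
  along (p *: w1 + w2) a = p * along w1 a + along w2 a.
Proof.
rewrite /along mulr_sumr -big_split /=; apply: eq_bigr => i _.
by rewrite !mxE scalerDr -scalerAr.
Qed.

Lemma along0 a : along 0 a = 0.
Proof. by rewrite /along big1 // => i _; rewrite mxE scaler0. Qed.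

Lemma alongZ p w a : along (p *: w) a = p * along w a.
Proof. by rewrite -[_ *: w]addr0 along_linear along0 addr0. Qed.

Lemma along_sum (T : Type) (s : seq T) (p : T -> S) (w : T -> 'rV[S]_l) a :
  along (\sum_(t <- s) p t *: w t) a = \sum_(t <- s) p t * along (w t) a.
Proof.
elim: s => [|t s IHs]; first by rewrite !big_nil along0.
by rewrite !big_cons along_linear IHs.
Qed.

Lemma along_homog w a d : (forall i, w 0 i \is d.-homog) -> along w a \is d.-homog.
Proof. by move=> hw; apply: rpred_sum => i _; apply: dhomogZ. Qed.

Definition tangent A w := {in A, forall a, mdvd (lform a) (along w a)}.

Definition reduced_seq A :=
  [/\ uniq A, 0 \notin A & {in A &, forall a a' (c : R), a = c *: a' -> a = a'}].

Lemma reduced_seqS A A' : uniq A -> {subset A <= A'} -> reduced_seq A' -> reduced_seq A.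
Proof.
move=> uA sub [_ n0 red]; split=> //; first by apply: contra n0; apply: sub.
by move=> a a' /sub aA /sub aA'; apply: red.
Qed.

(** Rank-two case: the members of s lie in the plane of a1 and b. If theta sends
   lform a1 to (lform a1) g, then theta - g E, for the Euler derivation E,
   kills lform a1, so it sends lform b, up to scalars, to the same polynomial as
   each lform a with a in s; that polynomial is thus divisible by all of them. *)
Lemma tangent_plane b a1 (s : seq 'rV[R]_l) w :
    reduced_seq (b :: a1 :: s) ->
    {in s, forall a, exists c d, a = c *: a1 + d *: b} ->
    tangent (a1 :: s) w ->
  mdvd (lform (proj_perp b a1) ^+ size s) (flat b (along w b)).
Proof.
move=> [/= /andP [bNs /andP [a1Ns us]] n0 red] comb tg.
have [g1 eg1] := tg a1 (mem_head _ _).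
pose t := along w b - lform b * g1.
have sub a : a \in s -> a \in b :: a1 :: s by move=> h; rewrite !inE h !orbT.
have b0 : b != 0 by apply: contraNneq n0 => <-; rewrite mem_head.
have [g eg] : mdvd (\prod_(a <- s) lform a ^+ 1%N) t.
  apply: (prod_lform_dvd (u := id) (n := fun=> 1%N)) => // [a /sub h|a a' /sub h /sub h'|a aS].
  - by apply: contraNneq n0 => <-.
  - exact: red.
  rewrite expr1; have [c [d ea]] := comb a aS.
  have d0 : d != 0.
    apply: contraNneq a1Ns => d0; rewrite d0 scale0r addr0 in ea.
    have a1t : a1 \in b :: a1 :: s by rewrite !inE eqxx orbT.
    by rewrite -(red a a1 (sub a aS) a1t c ea).
  have [g eg] : mdvd (lform a) (along w a) by apply: tg; rewrite inE aS orbT.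
  have dt : d *: t = lform a * (g - g1).
    have e1 : along w a = c *: along w a1 + d *: along w b.
      by rewrite {1}ea alongP -[d *: b]addr0 alongP along0r addr0.
    have e2 : lform a = c *: lform a1 + d *: lform b by rewrite ea linearD !linearZ.
    by rewrite mulrBr -eg e1 e2 eg1 /t -!mul_mpolyC; ring.
  exists (d^-1 *: (g - g1)); rewrite -scalerAr -dt scalerA mulVf ?scale1r //.
have <- : flat b t = flat b (along w b).
  by rewrite /flat /t raddfB /= -!/(flat b _) flatM flat_lform0 // mul0r subr0.
rewrite eg flatM; apply: mdvd_mulr.
have : {subset s <= s} by [].
elim: {1 3 4}s => [|a s' IHs] s's.
  by rewrite /= expr0 big_nil /flat comp_mpoly1; exists 1; rewrite mulr1.
rewrite big_cons expr1 flatM flat_lform.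
have [c [d ->]] := comb a (s's _ (mem_head _ _)).
rewrite proj_perpD !proj_perpZ proj_perp_id // scaler0 addr0 linearZ /=.
have [y as'|g' ->] := IHs; first by apply: s's; rewrite inE as' orbT.
by exists (c *: g'); rewrite exprS -scalerAl -scalerAr mulrA.
Qed.

Definition plane b a : {vspace 'rV[R]_l} := (<[a]> + <[b]>)%VS.

Definition planes b A := undup [seq plane b a | a <- A].

Definition fiber b A P := [seq a <- A | plane b a == P].

Lemma plane_eq b a a' c d : c != 0 -> a = c *: a' + d *: b -> plane b a = plane b a'.
Proof.
move=> c0 ea; apply/eqP; rewrite eqEsubv /plane !subv_add !addvSr !andbT -!memvE.
apply/andP; split.
  by rewrite ea memv_add // memvZ ?memv_line.
have -> : a' = c^-1 *: a + - (c^-1 * d) *: b.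
  by rewrite ea scalerDr !scalerA mulVf // scale1r scaleNr addrK.
by rewrite memv_add // memvZ ?memv_line.
Qed.

Lemma planeP b a a' : plane b a = plane b a' -> exists c d, a = c *: a' + d *: b.
Proof.
move=> e; have : a \in plane b a'.
  by rewrite -e; apply: (subvP (addvSl _ _)); apply: memv_line.
by case/memv_addP => _ /vlineP [c ->] [_ /vlineP [d ->] ->]; exists c, d.
Qed.

(** Up to a scalar: the restriction to the hyperplane orthogonal to b of the
   product of the lform a, over a in A, with one factor removed for every
   hyperplane of the restricted arrangement. These hyperplanes correspond to the
   planes through b and a member of A. *)
Definition restr b A : S :=
  \prod_(P <- planes b A)
     lform (proj_perp b (head 0 (fiber b A P))) ^+ (size (fiber b A P)).-1.

Definition restr_deg b A : nat := (\sum_(P <- planes b A) (size (fiber b A P)).-1)%N.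

Lemma restr_homog b A : restr b A \is (restr_deg b A).-homog.
Proof.
rewrite /restr /restr_deg; elim/big_rec2: _ => [|P d q _ hq]; first exact: dhomog1.
apply: dhomogM hq.
by have := dhomogMn (size (fiber b A P)).-1
  (lform_homog (proj_perp b (head 0 (fiber b A P)))); rewrite mul1n.
Qed.

Lemma fiber_head b A P : P \in planes b A ->
  exists s, fiber b A P = head 0 (fiber b A P) :: s.
Proof.
rewrite mem_undup => /mapP [a aA ->].
have : a \in fiber b A (plane b a) by rewrite mem_filter eqxx.
by case: fiber => // a' s _; exists s.
Qed.

Lemma fiber_headP b A P : P \in planes b A ->
  head 0 (fiber b A P) \in A /\ plane b (head 0 (fiber b A P)) = P.
Proof.
move=> /fiber_head [s e].
have : head 0 (fiber b A P) \in fiber b A P by rewrite e mem_head.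
by rewrite mem_filter => /andP [/eqP].
Qed.

(** The forms of distinct planes remain pairwise independent on the hyperplane
   orthogonal to b, so the divisibilities obtained plane by plane multiply. *)
Lemma tangent_restr b A w : reduced_seq (b :: A) -> tangent A w ->
  mdvd (restr b A) (flat b (along w b)).
Proof.
move=> red; have [/= /andP [bA uA] n0 nonprop] := red => tg.
have Nline a d : a \in A -> a <> d *: b.
  move=> aA /(nonprop a b _ _ d) eab; case/negP: bA.
  by rewrite -eab ?mem_head // inE aA orbT.
apply: prod_lform_dvd => [|P hP|P P' hP hP' c|P hP].
- exact: undup_uniq.
- have [hA _] := fiber_headP hP; apply/eqP => p0.
  have [|d] := @proj_perp_line _ _ b (head 0 (fiber b A P)) 0 0; first by rewrite p0 scale0r.
  by rewrite scaler0 add0r; apply: Nline.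
- have [hA eP] := fiber_headP hP; have [hA' eP'] := fiber_headP hP'.
  move=> /proj_perp_line [d ed]; rewrite -eP -eP'; apply: (plane_eq _ ed).
  by apply/eqP => c0; apply: (@Nline _ d hA); rewrite ed c0 scale0r add0r.
have [s es] := fiber_head hP.
have fib a : a \in fiber b A P -> a \in A /\ plane b a = P.
  by rewrite mem_filter => /andP [/eqP].
rewrite {2}es /=; apply: tangent_plane.
- rewrite -es; apply: reduced_seqS red => /=.
    by rewrite filter_uniq // andbT; apply: contra bA => /fib [].
  by move=> a; rewrite !inE => /orP [->//|/fib [->]]; rewrite orbT.
- move=> a aS; apply: planeP; have [_ ->] : a \in A /\ plane b a = P.
    by apply: fib; rewrite es inE aS orbT.
  by have [_ ->] := fiber_headP hP.
by move=> a; rewrite -es => /fib [aA _]; apply: tg.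
Qed.

Lemma meval_restr b A x : dot b x = 0 -> {in A, forall a, dot a x != 0} ->
  (restr b A).@[x 0] != 0.
Proof.
move=> bx ax; rewrite /restr big_seq; elim/big_rec: _ => [|P q hP hq].
  by rewrite meval1 oner_eq0.
rewrite mevalM mulf_neq0 // rmorphXn /= expf_neq0 // meval_lform dot_proj_perp //.
by apply: ax; have [] := fiber_headP hP.
Qed.

End VectorFields.

(** * Adding one hyperplane *)

Section Addition.
Variables (R : realType) (l : nat).
Implicit Types (a b u v x : 'rV[R]_l) (A B : seq 'rV[R]_l).
Local Notation S := {mpoly R[l]}.
Implicit Types (w : 'rV[S]_l) (p : S) (th : 'I_l -> 'rV[S]_l) (e : 'I_l -> nat).

Definition tangent_basis A th e : Prop :=
  [/\ forall i, tangent A (th i),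
      forall i j, th i 0 j \is (e i).-homog,
      forall w, tangent A w -> exists p : 'I_l -> S, w = \sum_i p i *: th i
    & forall p : 'I_l -> S, \sum_i p i *: th i = 0 -> forall i, p i = 0].

Lemma tangent_basis_ext A A' th e : A =i A' -> tangent_basis A th e -> tangent_basis A' th e.
Proof.
move=> eA [t h g f]; split=> // [i a|w tw]; first by rewrite -eA; apply: t.
by apply: g => a; rewrite eA; apply: tw.
Qed.

Lemma tangent_linear A w1 w2 p : tangent A w1 -> tangent A w2 -> tangent A (p *: w1 + w2).
Proof.
move=> t1 t2 a aA; rewrite along_linear; apply: mdvdD; last exact: t2.
exact/mdvd_mull/t1.
Qed.

Definition add_field b th (g : 'I_l -> S) q i :=
  if i == q then lform b *: th q else th i - g i *: th q.

Lemma add_field_sum b th g q (p : 'I_l -> S) :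
  \sum_i p i *: add_field b th g q i
  = \sum_i (if i == q then p q * lform b - \sum_(j | j != q) p j * g j else p i) *: th i.
Proof.
rewrite (bigD1 q) //= [RHS](bigD1 q) //= /add_field !eqxx.
rewrite (eq_bigr (fun i => p i *: th i - (p i * g i) *: th q)); last first.
  by move=> i /negPf ->; rewrite scalerBr scalerA.
rewrite sumrB scalerBl -scaler_suml scalerA -addrA; congr (_ + _).
by rewrite addrC; congr (_ + _); apply: eq_bigr => i /negPf ->.
Qed.

(** A tangent field sends lform b to f times a coefficient, modulo lform b, and
   it is tangent to the new hyperplane exactly when this coefficient is divisible by
   lform b, which is prime and does not divide f. Subtracting multiples
   of th q makes the coefficient of every other basis field zero. *)
Lemma addition A b th e q f (g h : 'I_l -> S) :
    tangent_basis A th e -> b != 0 -> ~ mdvd (lform b) f ->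
    (forall i, along (th i) b = f * g i + lform b * h i) -> g q = 1 ->
    (forall i, (e i < e q)%N -> g i = 0) ->
    (forall i, (e q <= e i)%N -> g i \is (e i - e q).-homog) ->
  tangent_basis (b :: A) (add_field b th g q)
    (fun i => if i == q then (e q).+1 else e i).
Proof.
move=> [tg hom gen free] b0 fb eg gq glow ghom.
have homg i j : (g i *: th q) 0 j \is (e i).-homog.
  rewrite mxE; case: (ltnP (e i) (e q)) => [/glow ->|le]; first by rewrite mul0r rpred0.
  by have := dhomogM (ghom i le) (hom q j); rewrite subnK.
split.
- move=> i a; rewrite inE => /orP [/eqP ->|aA]; last first.
    rewrite /add_field; case: ifP => _.
      rewrite -[_ *: _]addr0; apply: tangent_linear => // c _.
      by exists 0; rewrite along0 mulr0.
    by rewrite addrC -scaleNr; apply: tangent_linear.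
  rewrite /add_field; case: ifP => _; first by rewrite alongZ; eexists.
  rewrite addrC -scaleNr along_linear !eg gq.
  by exists (h i - g i * h q); ring.
- move=> i j; rewrite /add_field; case: ifP => _.
    by rewrite mxE; have := dhomogM (lform_homog b) (hom q j).
  by rewrite !mxE rpredB //; have := homg i j; rewrite mxE.
- move=> w tw; have [|p ep] := gen w.
    by move=> a aA; apply: tw; rewrite inE aA orbT.
  have [r er] : mdvd (lform b) (\sum_i p i * g i).
    have dfg : mdvd (lform b) (f * \sum_i p i * g i).
      have := tw b (mem_head _ _); rewrite ep along_sum => d1.
      have -> : f * (\sum_i p i * g i)
         = \sum_i p i * along (th i) b - \sum_i lform b * (p i * h i).
        rewrite mulr_sumr -sumrB; apply: eq_bigr => i _; rewrite eg; ring.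
      apply: mdvdB => //; apply: mdvd_sum => i; by eexists.
    by have [/fb|] := lform_prime b0 dfg.
  exists (fun i => if i == q then r else p i).
  rewrite add_field_sum ep; apply: eq_bigr => i _; case: eqP => [->|//].
  rewrite eqxx [r * _]mulrC -er (bigD1 q) //= gq mulr1.
  congr (_ *: _); rewrite [X in _ - X](eq_bigr (fun j => p j * g j)) ?addrK //.
  by move=> j /negPf ->.
move=> p; rewrite add_field_sum => /free p0.
have pn i : i != q -> p i = 0 by move=> /negPf iq; have := p0 i; rewrite iq.
move=> i; have [->|/pn //] := eqVneq i q.
have := p0 q; rewrite eqxx big1 ?subr0 => [/eqP|j /pn ->]; last by rewrite mul0r.
by rewrite mulf_eq0 lform_eq0 (negPf b0) orbF => /eqP.
Qed.

Definition field_at x w : 'rV[R]_l := map_mx (meval (x 0)) w.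

Lemma field_atP x p w1 w2 :
  field_at x (p *: w1 + w2) = p.@[x 0] *: field_at x w1 + field_at x w2.
Proof. by apply/rowP => i; rewrite !mxE mevalD mevalM. Qed.

Lemma field_at0 x : field_at x 0 = 0.
Proof. by apply/rowP => i; rewrite !mxE meval0. Qed.

Lemma field_atZ x p w : field_at x (p *: w) = p.@[x 0] *: field_at x w.
Proof. by rewrite -[_ *: w]addr0 field_atP field_at0 addr0. Qed.

Lemma field_at_sum x (p : 'I_l -> S) th :
  field_at x (\sum_i p i *: th i) = \sum_i (p i).@[x 0] *: field_at x (th i).
Proof.
elim/big_rec2: _ => [|i u w _ <-]; first exact: field_at0.
by rewrite field_atP.
Qed.

Lemma dot_field_at x w b : dot b (field_at x w) = (along w b).@[x 0].
Proof.
rewrite /along raddf_sum; apply: eq_bigr => i _.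
by rewrite /= mevalZ !mxE.
Qed.

(** The product of the forms of A times any constant field is tangent, and off
   the hyperplanes of A this product is invertible. *)
Lemma tangent_basis_span A th e x : tangent_basis A th e ->
    {in A, forall a, dot a x != 0} ->
  forall v, exists c : 'I_l -> R, v = \sum_i c i *: field_at x (th i).
Proof.
move=> [_ _ gen _] ax v.
pose Q : S := \prod_(a <- A) lform a.
have Qx : Q.@[x 0] != 0.
  rewrite /Q big_seq; elim/big_rec: _ => [|a q aA hq]; first by rewrite meval1 oner_eq0.
  by rewrite mevalM mulf_neq0 // meval_lform ax.
have [|p ep] := gen (Q *: map_mx (@mpolyC l R) v).
  move=> a aA; rewrite alongZ; apply: mdvd_mulr.
  by rewrite /Q (big_rem a) //=; eexists.
exists (fun i => (Q.@[x 0])^-1 * (p i).@[x 0]).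
under eq_bigr do rewrite -scalerA.
rewrite -scaler_sumr -field_at_sum -ep field_atZ scalerA mulVf // scale1r.
by apply/rowP => i; rewrite !mxE mevalC.
Qed.

Lemma orthogonal_projection (s : seq 'rV[R]_l) v :
  exists2 w, w \in <<s>>%VS & {in s, forall b, dot b (v - w) = 0}.
Proof.
elim: s v => [|b s IHs] v; first by exists 0; rewrite ?mem0v.
have [w1 w1s o1] := IHs v; have [w2 w2s o2] := IHs b.
(* One step of the Gram-Schmidt process: u is orthogonal to s. *)
pose u := b - w2; pose c := dot u (v - w1) / dot u u.
have sub y : y \in <<s>>%VS -> y \in <<b :: s>>%VS.
  have /subvP : (<<s>> <= <<b :: s>>)%VS by apply: sub_span => z zs; rewrite inE zs orbT.
  by apply.
have bs : b \in <<b :: s>>%VS by apply: memv_span; rewrite mem_head.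
exists (w1 + c *: u); first by rewrite memvD ?memvZ ?memvB ?bs ?sub.
have os : {in s, forall y, dot y (v - (w1 + c *: u)) = 0}.
  by move=> y ys; rewrite opprD addrA dotBr dotZr o1 // o2 // mulr0 subr0.
have ospan y : y \in <<s>>%VS -> dot y (v - (w1 + c *: u)) = 0.
  move=> ys; rewrite (coord_span (X := in_tuple s) ys) dot_suml big1 // => i _.
  by rewrite dotZl os ?mulr0 // mem_nth.
have ou : dot u (v - (w1 + c *: u)) = 0.
  rewrite opprD addrA dotBr dotZr /c; have [->|u0] := eqVneq u 0.
    by rewrite !dot0l mulr0 subr0.
  by rewrite divfK ?dot_eq0 // subrr.
move=> y; rewrite inE => /orP [/eqP ->|/os //].
by rewrite -[b](subrK w2) dotDl ou ospan // addr0.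
Qed.

Lemma span_separation (s : seq 'rV[R]_l) v : v \notin <<s>>%VS ->
  exists2 x, {in s, forall b, dot b x = 0} & dot v x != 0.
Proof.
move=> vs; have [w ws ow] := orthogonal_projection s v.
exists (v - w) => //.
have wo : dot w (v - w) = 0.
  rewrite {1}(coord_span (X := in_tuple s) ws) dot_suml big1 // => i _.
  by rewrite dotZl ow ?mulr0 // mem_nth.
rewrite -[v in dot v _](subrK w) dotDl wo addr0 dot_eq0 subr_eq0.
by apply: contraNneq vs => ->.
Qed.

(** Finitely many hyperplanes that do not contain the orthogonal complement of
   s do not cover it: from a point off those of A, move in a direction that
   leaves the hyperplane of a. *)
Lemma generic_point (s A : seq 'rV[R]_l) : {in A, forall a, a \notin <<s>>%VS} ->
  exists2 x, {in s, forall b, dot b x = 0} & {in A, forall a, dot a x != 0}.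
Proof.
elim: A => [|a A IHA] nA; first by exists 0 => // b _; apply: dot0r.
have [|x xs xA] := IHA; first by move=> b bA; apply: nA; rewrite inE bA orbT.
have [y ys ya] := span_separation (nA a (mem_head _ _)).
(* Larger in absolute value than every parameter to be avoided. *)
pose t : R := 1 + \sum_(b <- a :: A) `|dot b x / dot b y|.
exists (x + t *: y) => [b bs|b bA]; first by rewrite dotDr dotZr xs // ys // mulr0 addr0.
rewrite dotDr dotZr; have [y0|y0] := eqVneq (dot b y) 0.
  rewrite y0 mulr0 addr0; move: bA; rewrite inE => /orP [/eqP eb|/xA //].
  by rewrite -eb y0 eqxx in ya.
apply/eqP => e; have : t = - (dot b x / dot b y).
  by apply: (mulIf y0); rewrite mulNr divfK //; apply/eqP; rewrite -addr_eq0 addrC e.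
have : `|dot b x / dot b y| < t.
  rewrite /t (big_rem b) //= addrCA ltrDl ltr_wpDr ?ltr01 //.
  by apply: sumr_ge0.
have := ler_norm (- (dot b x / dot b y)); rewrite normrN => h1 h2 h3.
by move: h2; rewrite h3 ltNge h1.
Qed.

End Addition.

(** * Adding several hyperplanes with the same pivot degree *)

Section Level.
Variables (R : realType) (l : nat).
Implicit Types (a b u v x : 'rV[R]_l) (A B : seq 'rV[R]_l).
Local Notation S := {mpoly R[l]}.
Implicit Types (w : 'rV[S]_l) (p : S) (th : 'I_l -> 'rV[S]_l) (e : 'I_l -> nat).

Lemma along_restr b A th e : reduced_seq (b :: A) ->
    (forall i, tangent A (th i)) -> (forall i j, th i 0 j \is (e i).-homog) ->
  exists (g h : 'I_l -> S), forall i,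
    [/\ along (th i) b = restr b A * g i + lform b * h i,
        (e i < restr_deg b A)%N -> g i = 0
      & (restr_deg b A <= e i)%N -> g i \is (e i - restr_deg b A).-homog].
Proof.
move=> red tg hom.
have cofactor i : exists y : S,
    [/\ flat b (along (th i) b) = restr b A * y,
        (e i < restr_deg b A)%N -> y = 0
      & (restr_deg b A <= e i)%N -> y \is (e i - restr_deg b A).-homog].
  have [y ey] := tangent_restr red (tg i).
  rewrite ey; apply: homog_cofactor; first exact: restr_homog.
  by rewrite -ey flat_homog // along_homog.
have [g hg] := fin_all_exists cofactor.
have [h hh] := fin_all_exists (fun i => flatP b (along (th i) b)).
exists g, h => i; have [e1 e2 e3] := hg i; split=> //.
by rewrite -hh -e1 addrCA subrr addr0.
Qed.

(** Multiple addition. At a point x where all of B but no member of A vanishes, the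
   values of the basis fields of degree at most k span the tangent vectors
   killed by the members of B added so far. By independence of B such a vector is not
   killed by the next member b; so some field of degree at most k has a nonzero
   coefficient on restr b A, whose degree is at least k. This field has degree k and its
   coefficient is a constant: it can serve as a pivot. *)
Lemma multiple_addition A B k th e x :
    tangent_basis A th e -> (forall i, (e i <= k)%N) ->
    {in B, forall b, reduced_seq (b :: A)} -> free B ->
    {in B, forall b, (k <= restr_deg b A)%N} ->
    {in B, forall b, dot b x = 0} -> {in A, forall a, dot a x != 0} ->
  exists th' e',
    [/\ tangent_basis (B ++ A) th' e', forall i, (e' i <= k.+1)%N,
        forall j, (j <= k)%N -> #|[pred i | (j <= e' i)%N]| = #|[pred i | (j <= e i)%N]|
      & #|[pred i | (k < e' i)%N]| = size B].
Proof.
move=> bas ek redB freeB degB xB xA.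
suff [th' [e' [? ? ? ? _]]] : exists th' e',
    [/\ tangent_basis (B ++ A) th' e', forall i, (e' i <= k.+1)%N,
        forall j, (j <= k)%N -> #|[pred i | (j <= e' i)%N]| = #|[pred i | (j <= e i)%N]|,
        #|[pred i | (k < e' i)%N]| = size B
      & forall v, {in B, forall b, dot b v = 0} -> exists c : 'I_l -> R,
          (forall i, (k < e' i)%N -> c i = 0) /\ v = \sum_i c i *: field_at x (th' i)].
  by exists th', e'.
elim: B freeB redB degB xB => [|b B IHB] freeB redB degB xB.
  exists th, e; split=> // [i||v _]; first exact: leqW.
    by apply: eq_card0 => i; rewrite !inE ltnNge ek.
  have [c ec] := tangent_basis_span bas xA v.
  by exists c; split=> // i; rewrite ltnNge ek.
move: freeB; rewrite free_cons => /andP [bNB freeB].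
have sub y : y \in B -> y \in b :: B by move=> yB; rewrite inE yB orbT.
have [y /sub|y /sub|y /sub|th1 [e1 [bas1 ek1 cnt1 top1 span1]]] := IHB freeB.
- exact: redB.
- exact: degB.
- exact: xB.
have bb : b \in b :: B := mem_head _ _.
have b0 : b != 0.
  by have [_ n0 _] := redB b bb; apply: contraNneq n0 => <-; rewrite mem_head.
have [tg1 hom1 gen1 free1] := bas1.
have [g [h gh]] : exists (g h : 'I_l -> S), forall i,
    [/\ along (th1 i) b = restr b A * g i + lform b * h i,
        (e1 i < restr_deg b A)%N -> g i = 0
      & (restr_deg b A <= e1 i)%N -> g i \is (e1 i - restr_deg b A).-homog].
  apply: along_restr hom1; first exact: redB.
  by move=> i a aA; apply: tg1; rewrite mem_cat aA orbT.
have fx : (restr b A).@[x 0] != 0 by apply: meval_restr => //; apply: xB.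
have dotb i : dot b (field_at x (th1 i)) = (restr b A).@[x 0] * (g i).@[x 0].
  rewrite dot_field_at; have [-> _ _] := gh i.
  by rewrite mevalD !mevalM meval_lform xB // mul0r addr0.
have [v0 v0B v0b] := span_separation bNB.
have [c0 [c0k ev0]] := span1 v0 v0B.
have [q c0q gq] : exists2 q, c0 q != 0 & (g q).@[x 0] != 0.
  move: v0b; rewrite ev0 dot_sumr.
  have [[q /andP [? ?]] _|none] :=
    altP (@existsP _ (fun q => (c0 q != 0) && ((g q).@[x 0] != 0))); first by exists q.
  rewrite big1 ?eqxx // => i _; rewrite dotZr dotb.
  move: none; rewrite negb_exists => /forallP /(_ i); rewrite negb_and !negbK.
  by case/orP => /eqP ->; rewrite ?mulr0 ?mul0r.
have eqk : (e1 q <= k)%N by rewrite leqNgt; apply: contra c0q => /c0k ->.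
have degq : (restr_deg b A <= e1 q)%N.
  by rewrite leqNgt; apply: contra gq => lt; have [_ /(_ lt) -> _] := gh q; rewrite meval0.
have Dk : restr_deg b A = k.
  by apply/eqP; rewrite eqn_leq (leq_trans degq eqk) degB.
have {eqk degq} eqk : e1 q = k by apply/eqP; rewrite eqn_leq eqk -{1}Dk.
have [c c0' egq] : exists2 c : R, c != 0 & g q = c%:MP.
  have [_ _] := gh q; rewrite Dk eqk leqnn subnn => /(_ isT) hg.
  have egq : g q = ((g q)@_0)%:MP.
    apply/mpolyP => m; rewrite mcoeffC; have [->|m0] := eqVneq m 0%MM; first by rewrite mulr1.
    by rewrite mulr0 (dhomog_nemf_coeff hg) ?mdeg_eq0.
  by exists (g q)@_0 => //; apply: contraNneq gq => c0'; rewrite egq c0' meval0.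
(* Moving the constant c from the coefficients to restr b A makes the pivot
   coefficient 1. *)
pose g' i := c^-1 *: g i.
have g'q : g' q = 1 by rewrite /g' egq -mul_mpolyC -mpolyCM mulVf.
exists (add_field b th1 g' q), (fun i => if i == q then (e1 q).+1 else e1 i); split.
- rewrite cat_cons; apply: (addition (f := c *: restr b A) (h := h)) => //.
  + move=> [r er]; case/eqP: fx; apply: (mulfI c0').
    by rewrite -mevalZ er mevalM meval_lform xB // mul0r mulr0.
  + move=> i; have [-> _ _] := gh i.
    by rewrite /g' -scalerAr -scalerAl scalerA mulVf // scale1r.
  + move=> i; rewrite eqk -Dk => lt; have [_ /(_ lt) e0 _] := gh i.
    by rewrite /g' e0 scaler0.
  + move=> i; rewrite eqk -Dk => le; have [_ _ /(_ le)] := gh i.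
    by apply: dhomogZ.
- by move=> i; case: eqP => // _; rewrite eqk.
- move=> j jk; rewrite -cnt1 //; apply: eq_card => i; rewrite !inE.
  by case: eqP => // ->; rewrite eqk jk leqW.
- rewrite /= -top1 (cardD1 q) !inE eqxx eqk ltnSn add1n; congr _.+1.
  apply: eq_card => i; rewrite !inE; case: eqP => //= ->; by rewrite eqk ltnn.
move=> v vB; have [|c1 [c1k ev]] := span1 v; first by move=> y /sub /vB.
exists (fun i => if i == q then 0 else c1 i); split.
  by move=> i; case: eqP => // _; apply: c1k.
have cg : \sum_i c1 i * (g i).@[x 0] = 0.
  apply: (mulfI fx); rewrite mulr0; transitivity (dot b v); last exact: vB.
  rewrite {1}ev dot_sumr mulr_sumr.
  by apply: eq_bigr => i _; rewrite dotZr dotb mulrCA.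
rewrite {1}ev (bigD1 q) //= [RHS](bigD1 q) //= eqxx scale0r add0r.
rewrite [RHS](eq_bigr (fun i => c1 i *: field_at x (th1 i)
    - (c^-1 * (c1 i * (g i).@[x 0])) *: field_at x (th1 q))); last first.
  move=> i /negPf iq; rewrite /add_field iq addrC -scaleNr field_atP mevalN mevalZ.
  by rewrite scalerDr addrC scaleNr scalerN scalerA mulrCA.
rewrite sumrB -scaler_suml -mulr_sumr addrC; congr (_ + _).
have := cg; rewrite (bigD1 q) //= => /(canRL (addKr _)) ->.
by rewrite addr0 egq mevalC mulrN mulrCA mulVf // mulr1 scaleNr opprK.
Qed.

End Level.

(** * Positive roots in a subgroup and the half-sum of their coroots *)

Section Roots.
Variables (R : realType) (l : nat) (Phi : {fset 'rV[R]_l}) (Delta : l.-tuple 'rV[R]_l).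
Hypotheses (rs : root_system Phi) (ss : simple_system Phi Delta).
Implicit Types (a b u v : 'rV[R]_l).
Local Notation Pos := (pos_roots Phi Delta).

(** The linear extension of the height to all of V. *)
Definition lin_height v : R := \sum_(i < l) coord Delta i v.
Local Notation ht := lin_height.

Lemma htD u v : ht (u + v) = ht u + ht v.
Proof. by rewrite /ht -big_split; apply: eq_bigr => i _; rewrite linearD. Qed.

Lemma htZ c v : ht (c *: v) = c * ht v.
Proof. by rewrite /ht mulr_sumr; apply: eq_bigr => i _; rewrite linearZ. Qed.

Lemma htN v : ht (- v) = - ht v.
Proof. by rewrite -scaleN1r htZ mulN1r. Qed.

Lemma htB u v : ht (u - v) = ht u - ht v.
Proof. by rewrite htD htN. Qed.

Lemma ht0 : ht 0 = 0.
Proof. by rewrite -(scale0r (0 : 'rV[R]_l)) htZ mul0r. Qed.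

Lemma ht_sum (T : Type) (s : seq T) (P : pred T) (F : T -> 'rV[R]_l) :
  ht (\sum_(t <- s | P t) F t) = \sum_(t <- s | P t) ht (F t).
Proof. exact: (big_morph _ htD ht0). Qed.

Lemma nat_combD u v : nat_comb Delta u -> nat_comb Delta v -> nat_comb Delta (u + v).
Proof.
move=> /forallP hu /forallP hv; apply/forallP => i.
by rewrite linearD rpredD ?hu ?hv.
Qed.

Lemma nat_comb_ht v : nat_comb Delta v -> ht v \is a Num.nat.
Proof. by move=> /forallP hv; apply: rpred_sum. Qed.

Lemma nat_comb_ht_ge1 v : nat_comb Delta v -> v != 0 -> 1 <= ht v.
Proof.
move=> nv v0; have /natrP [n hn] := nat_comb_ht nv.
rewrite hn ler1n lt0n; apply: contraNneq v0 => n0; move: hn; rewrite n0.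
move/eqP; rewrite psumr_eq0 => [/allP c0|i _]; last first.
  by have /forallP /(_ i) := nv; exact: natr_ge0.
rewrite (coord_basis (simple_basis ss) (memvf v)) big1 // => i _.
by have /eqP -> := c0 i (mem_index_enum _); rewrite scale0r.
Qed.

Lemma mem_pos a : (a \in Pos) = (a \in Phi) && nat_comb Delta a.
Proof. by rewrite !inE. Qed.

Lemma root_pos a : a \in Pos -> a \in Phi.
Proof. by rewrite mem_pos => /andP []. Qed.

Lemma root_ne0 a : a \in Phi -> a != 0.
Proof. by move=> ha; apply: contraNneq (root_neq0 rs) => <-. Qed.

Lemma pos_ht_ge1 a : a \in Pos -> 1 <= ht a.
Proof. by rewrite mem_pos => /andP [/root_ne0 a0 /nat_comb_ht_ge1]; apply. Qed.

Lemma pos_ht_gt0 a : a \in Pos -> 0 < ht a.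
Proof. by move=> /pos_ht_ge1; apply: lt_le_trans. Qed.

Lemma cartanD u v a : cartan (u + v) a = cartan u a + cartan v a.
Proof. by rewrite /cartan dotDl mulrDr mulrDl. Qed.

Lemma cartanZ c v a : cartan (c *: v) a = c * cartan v a.
Proof. by rewrite /cartan dotZl mulrCA !mulrA. Qed.

Lemma cartan_id a : a != 0 -> cartan a a = 2.
Proof. by move=> a0; rewrite /cartan mulfK // dot_eq0. Qed.

Lemma reflection_id a : a != 0 -> reflection a a = - a.
Proof.
by move=> a0; rewrite /reflection cartan_id // scaler_nat mulr2n opprD addrA subrr add0r.
Qed.

Lemma reflectionD c u v : reflection c (u + v) = reflection c u + reflection c v.
Proof. by rewrite /reflection cartanD scalerDl opprD addrACA. Qed.

Lemma reflectionK a : a != 0 -> involutive (reflection a).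
Proof.
move=> a0 v; rewrite /reflection -scaleNr cartanD cartanZ cartan_id //.
rewrite (_ : cartan v a + - cartan v a * 2 = - cartan v a); last by ring.
by rewrite !scaleNr opprK subrK.
Qed.

Lemma dot_reflection c u v : c != 0 -> dot (reflection c u) (reflection c v) = dot u v.
Proof.
move=> c0; have h : dot c c != 0 by rewrite dot_eq0.
rewrite /reflection /cartan dotBl !dotBr !dotZr !dotZl [dot c v]dotC.
by field.
Qed.

Lemma rootN a : a \in Phi -> - a \in Phi.
Proof. by move=> ha; rewrite -reflection_id ?root_ne0 // (root_refl rs). Qed.

Lemma pos_or_neg a : a \in Phi -> a \in Pos \/ - a \in Pos.
Proof.
by move=> ha; rewrite !mem_pos ha rootN //; case: (simple_sign ss ha); [left|right].
Qed.

Lemma pos_ht a : a \in Phi -> 0 < ht a -> a \in Pos.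
Proof.
move=> ha; case: (pos_or_neg ha) => // /pos_ht_gt0.
by rewrite htN oppr_gt0 => /lt_trans h /h; rewrite ltxx.
Qed.

Lemma root_ht0 a : a \in Phi -> ht a != 0.
Proof.
move=> /pos_or_neg [] /pos_ht_gt0; rewrite ?htN ?oppr_gt0; first exact: lt0r_neq0.
by rewrite lt_neqAle => /andP [].
Qed.

Lemma heightE a : a \in Pos -> (height Delta a)%:R = ht a.
Proof.
by rewrite mem_pos => /andP [_ /nat_comb_ht h]; rewrite /height truncnK.
Qed.

Lemma height_gt0 a : a \in Pos -> (0 < height Delta a)%N.
Proof. by move=> ha; rewrite -(ltr_nat R) heightE // pos_ht_gt0. Qed.

Lemma root_ne2 a : a \in Phi -> a + a \notin Phi.
Proof.
move=> ha; apply/negP => h2; have : 2 *: a \in Phi by rewrite scaler_nat mulr2n.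
by move=> /(root_reduced rs ha) [] h; lra.
Qed.

Lemma cartan_gt0 a b : a \in Phi -> (0 < cartan b a) = (0 < dot a b).
Proof.
move=> /root_ne0; rewrite -dot_gt0 => a0.
by rewrite /cartan -mulrA pmulr_rgt0 // pmulr_lgt0 ?invr_gt0 // dotC.
Qed.

(** Two Cartan numbers that are both at least 2 would violate the strict
   Cauchy-Schwarz inequality, so one is 1 and a reflection gives the
   difference. *)
Lemma root_sub a b : a \in Phi -> b \in Phi -> a != b -> 0 < dot a b -> a - b \in Phi.
Proof.
move=> ha hb ab dab.
have aa : 0 < dot a a by rewrite dot_gt0 root_ne0.
have bb : 0 < dot b b by rewrite dot_gt0 root_ne0.
have /intrP [m em] := root_crystallographic rs ha hb.
have /intrP [n en] := root_crystallographic rs hb ha.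
have m0 : (0 < m)%R by rewrite -(ltr0z R) -em cartan_gt0.
have n0 : (0 < n)%R by rewrite -(ltr0z R) -en cartan_gt0 // dotC.
have [m1|m1] := eqVneq m 1.
  have := root_refl rs ha hb; rewrite /reflection em m1 scale1r => /rootN.
  by rewrite opprB.
have [n1|n1] := eqVneq n 1.
  by have := root_refl rs hb ha; rewrite /reflection en n1 scale1r.
have m2 : 2 <= cartan b a.
  by rewrite em -[2]/(2%:~R) ler_int (lezD1 1) lt_neqAle eq_sym m1 -gtz0_ge1.
have n2 : 2 <= cartan a b.
  by rewrite en -[2]/(2%:~R) ler_int (lezD1 1) lt_neqAle eq_sym n1 -gtz0_ge1.
have ea : cartan b a * dot a a = 2 * dot a b by rewrite divfK ?gt_eqF // dotC.
have eb : cartan a b * dot b b = 2 * dot a b by rewrite divfK ?gt_eqF.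
have le1 : dot a a <= dot a b by nra.
have le2 : dot b b <= dot a b by nra.
have : dot (a - b) (a - b) <= 0.
  by rewrite dotBl !dotBr [dot b a]dotC; lra.
rewrite le_eqVlt ltNge dot_ge0 orbF dot_eq0 subr_eq0 => /eqP e.
by rewrite e eqxx in ab.
Qed.

Lemma same_height_obtuse a b : a \in Phi -> b \in Phi -> ht a = ht b -> a != b ->
  dot a b <= 0.
Proof.
move=> ha hb e ab; rewrite leNgt; apply/negP => /(root_sub ha hb ab) /root_ht0.
by rewrite htB e subrr eqxx.
Qed.

(** The positive roots in a subgroup G of V behave like a positive system. The
   subgroups in use are V itself, the planes through a given root, and the
   vectors of a subspace whose height is a multiple of a given number. *)
Section Subgroup.
Variable (G : {pred 'rV[R]_l}).
Hypothesis (Gz : zmod_closed G).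

Definition pos_in : seq 'rV[R]_l := [seq a <- Pos | a \in G].

Definition indecomposable c := (c \in pos_in) && all (fun a => c - a \notin pos_in) pos_in.

(** Pairing with the half-sum of the positive coroots in G. *)
Definition half_coroot_sum v : R := 2^-1 * \sum_(a <- pos_in) cartan v a.

Lemma mem_pos_in a : (a \in pos_in) = (a \in Pos) && (a \in G).
Proof. by rewrite mem_filter andbC. Qed.

Lemma pos_inP a : a \in pos_in -> a \in Pos /\ a \in G.
Proof. by rewrite mem_pos_in => /andP. Qed.

Let G_sub u v : u \in G -> v \in G -> u - v \in G.
Proof. by case: Gz => _; apply. Qed.

Let G_opp u : u \in G -> - u \in G.
Proof. by rewrite -sub0r; apply: G_sub; case: Gz. Qed.

Let G_add u v : u \in G -> v \in G -> u + v \in G.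
Proof. by move=> hu hv; rewrite -[v]opprK G_sub // G_opp. Qed.

Lemma reflection_in a b : a \in Phi -> b \in Phi -> a \in G -> b \in G ->
  reflection a b \in G.
Proof.
move=> ha hb Ga Gb; have /intrP [z ez] := root_crystallographic rs ha hb.
rewrite /reflection ez G_sub // scaler_int.
have nat_mul n : a *+ n \in G.
  by elim: n => [|n IHn]; [case: Gz|rewrite mulrS G_add].
by case: z {ez} => n; [rewrite -pmulrn|rewrite NegzE mulrNz -pmulrn G_opp].
Qed.

Lemma indecomposableP c a : indecomposable c -> a \in pos_in -> c - a \in pos_in -> False.
Proof. by move=> /andP [_ /allP h] /h /negP. Qed.

(** If the reflection of a in c were negative, so would be that of a - c, which is
   again a positive root because c is indecomposable; descend on the height. *)
Lemma indecomposable_reflection c a : indecomposable c -> a \in pos_in -> a != c ->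
  reflection c a \in pos_in.
Proof.
move=> ic; have := ic => /andP [cin _].
have [cpos cG] := pos_inP cin; have cPhi := root_pos cpos.
have [n] := ubnP (height Delta a); elim: n a => // n IHn a han ain ac.
have [apos aG] := pos_inP ain; have aPhi := root_pos apos.
have rPhi := root_refl rs cPhi aPhi; have rG := reflection_in cPhi aPhi cG aG.
rewrite mem_pos_in rG andbT; case: (pos_or_neg rPhi) => // rneg; exfalso.
have dac : 0 < dot a c.
  rewrite dotC -cartan_gt0 // ltNge; apply/negP => le0.
  have := pos_ht_gt0 rneg; rewrite htN htB htZ oppr_gt0.
  have := pos_ht_gt0 apos; have := pos_ht_gt0 cpos; nra.
have dPhi := root_sub aPhi cPhi ac dac; have dG := G_sub aG cG.
have [dpos|] := pos_or_neg dPhi; last first.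
  rewrite opprB => dneg; apply: (indecomposableP ic ain).
  by rewrite mem_pos_in dneg G_sub.
have din : a - c \in pos_in by rewrite mem_pos_in dpos.
have dc : a - c != c.
  by rewrite subr_eq; apply: contraTneq aPhi => ->; apply: root_ne2.
have lt : (height Delta (a - c) < n)%N.
  rewrite -ltnS; apply: leq_trans han; rewrite ltnS -(ltr_nat R) !heightE // htB.
  by have := pos_ht_gt0 cpos; lra.
have := IHn _ lt din dc; rewrite reflectionD -scaleN1r.
have -> : reflection c (-1 *: c) = c.
  rewrite /reflection cartanZ cartan_id ?root_ne0 // scaleN1r mulN1r scaleNr opprK.
  by rewrite scaler_nat mulr2n addKr.
move=> rin; apply: (indecomposableP ic rin); rewrite opprD addrCA subrr addr0.
by rewrite mem_pos_in rneg G_opp.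
Qed.

Lemma half_coroot_sumD u v : half_coroot_sum (u + v) = half_coroot_sum u + half_coroot_sum v.
Proof.
rewrite /half_coroot_sum -mulrDr -big_split; congr (_ * _).
by apply: eq_bigr => a _; rewrite cartanD.
Qed.

Lemma half_coroot_sumZ c v : half_coroot_sum (c *: v) = c * half_coroot_sum v.
Proof.
rewrite /half_coroot_sum mulrCA; congr (_ * _); rewrite mulr_sumr.
by apply: eq_bigr => a _; rewrite cartanZ.
Qed.

Lemma half_coroot_sum_sum (T : Type) (s : seq T) (F : T -> 'rV[R]_l) :
  half_coroot_sum (\sum_(t <- s) F t) = \sum_(t <- s) half_coroot_sum (F t).
Proof.
have h0 : half_coroot_sum 0 = 0.
  have := half_coroot_sumZ 0 0; by rewrite scale0r mul0r.
exact: (big_morph _ half_coroot_sumD h0).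
Qed.

Lemma pos_in_uniq : uniq pos_in.
Proof. by rewrite filter_uniq // fset_uniq. Qed.

(** The reflection in c permutes the other positive roots in G and changes the sign of
   their pairings with c, which therefore cancel. *)
Lemma half_coroot_sum_indecomposable c : indecomposable c -> half_coroot_sum c = 1.
Proof.
move=> ic; have := ic => /andP [cin _].
have cPhi : c \in Phi by move: cin; rewrite mem_pos_in => /andP [/root_pos].
have c0 := root_ne0 cPhi.
rewrite /half_coroot_sum (bigD1_seq c) ?pos_in_uniq //= cartan_id //.
rewrite -big_filter; set s := filter _ _.
suff : \sum_(a <- s) cartan c a = 0 by move=> ->; rewrite addr0 mulVf ?pnatr_eq0.
have sP a : a \in s -> a \in pos_in /\ a != c by rewrite mem_filter => /andP [].
have us : uniq s by rewrite filter_uniq ?pos_in_uniq.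
have ps : perm_eq s (map (reflection c) s).
  apply: uniq_perm => //; first by rewrite map_inj_uniq //; apply: inv_inj; apply: reflectionK.
  have sub a : a \in s -> reflection c a \in s.
    move=> /sP [ain ac]; rewrite mem_filter indecomposable_reflection // andbT.
    apply: contraTneq ain => e; have -> : a = - c.
      by rewrite -[a](reflectionK c0) e reflection_id.
    apply/negP; rewrite mem_pos_in => /andP [/pos_ht_gt0 h _].
    move: cin; rewrite mem_pos_in => /andP [/pos_ht_gt0 h' _].
    by move: h; rewrite htN; lra.
  move=> a; apply/idP/mapP => [aS|[a' /sub h -> //]].
  by exists (reflection c a); [apply: sub|rewrite reflectionK].
have : \sum_(a <- s) cartan c a = - \sum_(a <- s) cartan c a.
  rewrite {1}(perm_big _ ps) big_map -sumrN; apply: eq_bigr => a _.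
  have -> : cartan c (reflection c a) = 2 * dot c (reflection c a) / dot a a.
    by rewrite {1}/cartan dot_reflection.
  rewrite -{1}(reflectionK c0 c) dot_reflection // reflection_id //.
  by rewrite dotNl mulrN mulNr.
by lra.
Qed.

(** If b is a sum of two roots, one of them also has positive scalar product
   with a. *)
Lemma indecomposable_ex a b : b \in pos_in -> 0 < dot a b ->
  exists2 c, indecomposable c & 0 < dot a c.
Proof.
have [n] := ubnP (height Delta b); elim: n b => // n IHn b hbn bin dab.
have [ib|] := boolP (indecomposable b); first by exists b.
rewrite /indecomposable bin => /allPn [b1 b1in]; rewrite negbK => b2in.
have [bpos _] := pos_inP bin.
have [b1pos _] := pos_inP b1in.
have [b2pos _] := pos_inP b2in.
have [d1|d1] := ltP 0 (dot a b1).
  apply: (IHn b1) => //; rewrite -ltnS; apply: leq_trans hbn.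
  rewrite ltnS -(ltr_nat R) !heightE //.
  by have := pos_ht_gt0 b2pos; rewrite htB; lra.
apply: (IHn (b - b1)) => //.
  rewrite -ltnS; apply: leq_trans hbn; rewrite ltnS -(ltr_nat R) !heightE //.
  by have := pos_ht_gt0 b1pos; rewrite htB; lra.
by rewrite dotBr; lra.
Qed.

Definition below b := [seq a <- pos_in | nat_comb Delta (b - a) && (a != b)].

(** Subtracting indecomposable roots from b one after the other lowers the pairing
   by one each time and passes through distinct roots below b. When the pairing
   reaches 2, the next step writes the root as a sum of two roots, which both
   lie below it and make up for the missing unit. *)
Lemma half_coroot_sum_below b : b \in pos_in ->
  half_coroot_sum b = 1 \/ half_coroot_sum b <= (size (below b))%:R.
Proof.
have [n] := ubnP (height Delta b); elim: n b => // n IHn b hbn bin.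
have [bpos bG] := pos_inP bin; have bPhi := root_pos bpos.
have [|c ic dbc] := @indecomposable_ex b b bin; first by rewrite dot_gt0 root_ne0.
have [->|cb] := eqVneq b c; first by left; apply: half_coroot_sum_indecomposable.
right; have /andP [cin _] := ic.
have [cpos cG] := pos_inP cin; have cPhi := root_pos cpos.
have dPhi := root_sub bPhi cPhi cb dbc.
have [dpos|] := pos_or_neg dPhi; last first.
  rewrite opprB => dneg; exfalso; apply: (indecomposableP ic bin).
  by rewrite mem_pos_in dneg G_sub.
have din : b - c \in pos_in by rewrite mem_pos_in dpos G_sub.
have dht := pos_ht_gt0 dpos; have cht := pos_ht_gt0 cpos; rewrite htB in dht.
have lt : (height Delta (b - c) < n)%N.
  by rewrite -ltnS; apply: leq_trans hbn; rewrite ltnS -(ltr_nat R) !heightE // htB; lra.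
have fb : half_coroot_sum b = half_coroot_sum (b - c) + 1.
  by rewrite -(half_coroot_sum_indecomposable ic) -half_coroot_sumD subrK.
have comb a : a \in Pos -> nat_comb Delta a by rewrite mem_pos => /andP [].
have dbelow : b - c \in below b.
  rewrite mem_filter din andbT opprB addrCA subrr addr0 comb //=.
  by apply/eqP => /(congr1 ht); rewrite htB; lra.
have [f1|fle] := IHn _ lt din.
  rewrite fb f1 -[1 + 1]/(2%:R) ler_nat.
  have : uniq [:: c; b - c].
    rewrite /= inE andbT eq_sym subr_eq.
    by apply: contraTneq bPhi => ->; apply: root_ne2.
  move=> /uniq_leq_size; apply=> a; rewrite !inE => /orP [/eqP ->|/eqP ->] //.
  by rewrite mem_filter cin comb //= eq_sym cb.
rewrite fb; apply: (@le_trans _ _ (size (b - c :: below (b - c)))%:R).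
  by rewrite /= -natr1 lerD2r.
rewrite ler_nat; apply: uniq_leq_size.
  by rewrite /= mem_filter eqxx andbF filter_uniq // pos_in_uniq.
move=> a; rewrite inE => /orP [/eqP ->//|].
rewrite !mem_filter => /andP [/andP [nc ad] /andP [aG apos]].
rewrite aG apos !andbT; apply/andP; split.
  by rewrite -(subrK c b) -addrAC nat_combD // comb.
apply: contraTneq nc => ->; apply/negP => /nat_comb_ht /natr_ge0.
by rewrite !htB; lra.
Qed.

End Subgroup.

End Roots.

(** * The local-global formula for heights *)

Section Heights.
Variables (R : realType) (l : nat) (Phi : {fset 'rV[R]_l}) (Delta : l.-tuple 'rV[R]_l).
Hypotheses (rs : root_system Phi) (ss : simple_system Phi Delta).
Implicit Types (a b u v : 'rV[R]_l).
Local Notation Pos := (pos_roots Phi Delta).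
Local Notation ht := (lin_height Delta).

Fact zmod_closedT : zmod_closed (predT : {pred 'rV[R]_l}).
Proof. by split. Qed.

Lemma ht_simple (i : 'I_l) : ht Delta`_i = 1.
Proof.
have fr : free Delta by have /andP [] := simple_basis ss.
rewrite /lin_height (bigD1 i) //= coord_free // eqxx big1 ?addr0 // => j ji.
by rewrite coord_free // eq_sym (negPf ji).
Qed.

Lemma simple_indecomposable (i : 'I_l) : indecomposable Phi Delta predT Delta`_i.
Proof.
have fr : free Delta by have /andP [] := simple_basis ss.
have dPhi : Delta`_i \in Phi by apply: (simple_root ss); rewrite mem_nth // size_tuple.
apply/andP; split.
  by rewrite mem_pos_in andbT (pos_ht rs ss) // ht_simple.
apply/allP => a /pos_inP [/(pos_ht_ge1 rs ss) ha _]; apply/negP.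
move=> /pos_inP [/(pos_ht_ge1 rs ss) hb _].
by move: hb; rewrite htB ht_simple; lra.
Qed.

Lemma half_coroot_sumT v : half_coroot_sum Phi Delta predT v = ht v.
Proof.
rewrite (coord_basis (simple_basis ss) (memvf v)) half_coroot_sum_sum ht_sum.
apply: eq_bigr => i _; rewrite half_coroot_sumZ htZ ht_simple.
by rewrite (half_coroot_sum_indecomposable rs ss zmod_closedT (simple_indecomposable i)).
Qed.

Lemma pos_line a b c : a \in Pos -> b \in Pos -> a = c *: b -> a = b.
Proof.
move=> ha hb e; have := root_pos ha; rewrite e => /(root_reduced rs (root_pos hb)).
case=> c1; first by rewrite c1 scale1r.
have := pos_ht_gt0 rs ss ha; have := pos_ht_gt0 rs ss hb.
by rewrite e c1 htZ mulN1r oppr_gt0 => /lt_trans h /h; rewrite ltxx.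
Qed.

Lemma pos_reduced (s : seq 'rV[R]_l) : uniq s -> {subset s <= Pos} -> reduced_seq s.
Proof.
move=> us sub; split=> // [|a a' /sub ha /sub ha' c]; last exact: pos_line.
by apply/negP => /sub /root_pos h; have := root_neq0 rs; rewrite h.
Qed.

Lemma big_fibers (T T' : eqType) (s : seq T) (h : T -> T') (F : T -> R) :
  \sum_(a <- s) F a = \sum_(P <- undup (map h s)) \sum_(a <- s | h a == P) F a.
Proof.
under [RHS]eq_bigr do rewrite big_mkcond /=.
rewrite exchange_big /=; apply: eq_big_seq => a aS.
rewrite (bigD1_seq (h a)) ?undup_uniq ?mem_undup ?map_f //= eqxx big1 ?addr0 //.
by move=> P; rewrite eq_sym => /negPf ->.
Qed.

Lemma plane_pos_in a0 b : b \in Pos -> a0 \in Pos -> a0 != b ->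
  perm_eq (pos_in Phi Delta (mem (plane b a0)))
    (b :: fiber b [seq a <- Pos | a != b] (plane b a0)).
Proof.
move=> bpos a0pos a0b; apply: uniq_perm; first exact: pos_in_uniq.
  by rewrite /= /fiber !mem_filter eqxx andbF /= !filter_uniq // fset_uniq.
have ba0 : b \in plane b a0 by apply: (subvP (addvSr _ _)); apply: memv_line.
move=> a; rewrite mem_pos_in in_cons /fiber !mem_filter.
have [->|ab] /= := eqVneq a b; first by rewrite bpos.
rewrite [RHS]andbC; case: (boolP (a \in Pos)) => //= apos.
apply/idP/eqP => [|<-]; last by apply: (subvP (addvSl _ _)); apply: memv_line.
case/memv_addP => _ /vlineP [c ->] [_ /vlineP [d ->] ea]; apply: (plane_eq _ ea).
apply/eqP => c0; move: ea; rewrite c0 scale0r add0r => /(pos_line apos bpos) e.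
by rewrite e eqxx in ab.
Qed.

(** Half the sum of the pairings of b with the coroots of the other positive roots
   is ht b - 1, and it splits over the planes P through b. The part of P
   is at most the number of roots of P below b, minus one, or else it
   vanishes. *)
Lemma height_le_restr_deg (A : seq 'rV[R]_l) b : b \in Pos ->
    {in Pos, forall a, a != b -> nat_comb Delta (b - a) -> a \in A} ->
    uniq A -> {subset A <= Pos} -> b \notin A ->
  ((height Delta b).-1 <= restr_deg b A)%N.
Proof.
move=> bpos lowA uA subA bA.
pose N := [seq a <- Pos | a != b].
have AN a : a \in A -> a \in N.
  move=> aA; rewrite mem_filter subA // andbT.
  by apply: contraNneq bA => <-.
have htb : ht b = 1 + \sum_(P <- planes b N) 2^-1 * \sum_(a <- fiber b N P) cartan b a.
  rewrite -half_coroot_sumT /half_coroot_sum.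
  rewrite /pos_in (eq_filter (a2 := predT)) // filter_predT.
  rewrite (bigD1_seq b) ?fset_uniq //= cartan_id ?(root_ne0 rs) ?(root_pos bpos) //.
  rewrite mulrDr mulVf ?pnatr_eq0 //; congr (_ + _).
  rewrite -big_filter -/N (big_fibers N (plane b)) mulr_sumr.
  by apply: eq_bigr => P _; rewrite big_filter.
have loc P : P \in planes b N ->
    2^-1 * (\sum_(a <- fiber b N P) cartan b a) <= (size (fiber b A P)).-1%:R.
  rewrite mem_undup => /mapP [a0]; rewrite mem_filter => /andP [a0b a0pos] ->.
  set P0 := plane b a0.
  have cl : zmod_closed (mem P0).
    by split=> [|u v hu hv]; [apply: mem0v|apply: memvB].
  have ps := plane_pos_in bpos a0pos a0b; rewrite -/P0 -/N in ps.
  have e : half_coroot_sum Phi Delta (mem P0) b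
      = 1 + 2^-1 * \sum_(a <- fiber b N P0) cartan b a.
    rewrite /half_coroot_sum (perm_big _ ps) big_cons cartan_id; last first.
      exact: (root_ne0 rs (root_pos bpos)).
    by rewrite mulrDr mulVf ?pnatr_eq0.
  have bin : b \in pos_in Phi Delta (mem P0) by rewrite (perm_mem ps) mem_head.
  have [h1|hle] := half_coroot_sum_below rs ss cl bin.
    have -> : 2^-1 * (\sum_(a <- fiber b N P0) cartan b a) = 0 by move: h1; rewrite e; lra.
    exact: ler0n.
  have lesz : (size (below Phi Delta (mem P0) b) <= size (fiber b A P0))%N.
    apply: uniq_leq_size; first by rewrite filter_uniq // pos_in_uniq.
    move=> a; rewrite mem_filter => /andP [/andP [nc ab] ain].
    have [apos _] := pos_inP ain.
    have := ain; rewrite (perm_mem ps) inE (negPf ab) /= !mem_filter => /andP [-> _] /=.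
    exact: lowA.
  have h2 : 1 + 2^-1 * (\sum_(a <- fiber b N P0) cartan b a) <= (size (fiber b A P0))%:R.
    by rewrite -e; apply: (le_trans hle); rewrite ler_nat.
  case: (size _) h2 => [|n]; rewrite /= -?natr1; lra.
have subpl : {subset planes b A <= planes b N}.
  by move=> P; rewrite !mem_undup => /mapP [a /AN aN ->]; apply: map_f.
have sumA : (\sum_(P <- planes b N) (size (fiber b A P)).-1)%N = restr_deg b A.
  rewrite /restr_deg (bigID (mem (planes b A))) /= [X in (_ + X)%N]big1 ?addn0 => [|P hP].
    rewrite -big_filter; apply: perm_big; apply: uniq_perm; rewrite ?filter_uniq ?undup_uniq //.
    by move=> P; rewrite mem_filter andb_idr //; apply: subpl.
  have -> : fiber b A P = [::]; last by [].
  apply/eqP; rewrite -[_ == _]negbK -has_filter; apply: contra hP => /hasP [a aA /eqP <-].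
  by rewrite mem_undup map_f.
rewrite -(ler_nat R) -sumA natr_sum.
have : ht b - 1 <= \sum_(P <- planes b N) (size (fiber b A P)).-1%:R.
  by rewrite htb addrC addKr big_seq [X in _ <= X]big_seq; apply: ler_sum.
rewrite -(heightE bpos); have := height_gt0 rs ss bpos.
by case: (height Delta b) => // n _; rewrite -natr1 addrK.
Qed.

(** The standard argument: a vanishing combination splits into two equal
   nonnegative combinations with disjoint supports; obtuseness makes their
   common value isotropic, hence zero, and the height shows that all its
   coefficients vanish. *)
Lemma obtuse_free (s : seq 'rV[R]_l) : uniq s -> {in s, forall a, 0 < ht a} ->
  {in s &, forall a b, a != b -> dot a b <= 0} -> free s.
Proof.
move=> us hs obt; pose X := in_tuple s.
have Xs (i : 'I_(size s)) : X`_i \in s by apply: mem_nth.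
suff npos (k : 'I_(size s) -> R) : \sum_i k i *: X`_i = 0 -> forall i, k i <= 0.
  suff: free X by [].
  apply/freeP => k k0 i; apply/eqP; rewrite eq_le npos //=.
  rewrite -oppr_le0; apply: (npos (fun i => - k i)).
  by under eq_bigr do rewrite scaleNr; rewrite sumrN k0 oppr0.
move=> k0; pose u := \sum_(i | 0 < k i) k i *: X`_i.
have eu : u = \sum_(i | ~~ (0 < k i)) (- k i) *: X`_i.
  move: k0; rewrite (bigID (fun i => 0 < k i)) /= -/u => /eqP.
  rewrite addr_eq0 => /eqP ->; rewrite -sumrN.
  by apply: eq_bigr => i _; rewrite scaleNr.
have u0 : u = 0.
  apply/eqP; rewrite -dot_eq0 eq_le dot_ge0 andbT {2}eu dot_suml.
  apply: sumr_le0 => i ki; rewrite dot_sumr; apply: sumr_le0 => j; rewrite -leNgt => kj.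
  have ij : X`_i != X`_j.
    rewrite nth_uniq // ?ltn_ord //; apply: contraTneq ki => /val_inj ->.
    by rewrite -leNgt.
  rewrite dotZl dotZr; apply: mulr_ge0_le0; first exact: ltW.
  by apply: mulr_ge0_le0; [rewrite oppr_ge0|apply: obt].
move=> i; rewrite leNgt; apply/negP => ki.
have : ht u = 0 by rewrite u0 ht0.
rewrite ht_sum => /eqP; rewrite psumr_eq0 => [/allP /(_ i (mem_index_enum _))|j kj].
  by rewrite ki htZ mulf_eq0 !gt_eqF ?hs.
by rewrite htZ mulr_ge0 // ltW // hs.
Qed.

End Heights.

(** * Positive roots of the same height *)

Section SameHeight.
Variables (R : realType) (l : nat) (Phi : {fset 'rV[R]_l}) (Delta : l.-tuple 'rV[R]_l).
Hypotheses (rs : root_system Phi) (ss : simple_system Phi Delta).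
Implicit Types (a b u v : 'rV[R]_l).
Local Notation Pos := (pos_roots Phi Delta).
Local Notation ht := (lin_height Delta).

Lemma int_between0_2 (x : R) : x \is a Num.int -> 0 < x -> x < 2 -> x = 1.
Proof.
move=> /intrP [z ->]; rewrite ltr0z -[2]/(2%:~R) ltr_int => z0 z2.
by suff -> : z = 1 by []; apply/eqP; rewrite eq_le -ltzD1 z2 -gtz0_ge1.
Qed.

Lemma same_height_free (s : seq 'rV[R]_l) (K : R) : uniq s ->
  {in s, forall a, a \in Pos /\ ht a = K} -> free s.
Proof.
move=> us hs; apply: (obtuse_free (Delta := Delta) us) => [a /hs [/(pos_ht_gt0 rs ss)] //|].
move=> a b /hs [/root_pos ha ea] /hs [/root_pos hb eb].
by apply: (same_height_obtuse rs ss ha hb); rewrite ea.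
Qed.

Variables (B : seq 'rV[R]_l) (K : R).
Hypotheses (uB : uniq B) (hB : {in B, forall b, b \in Pos /\ ht b = K}) (K0 : 0 < K).

(** On the span of B, the height divided by K is the pairing with the
   half-sum of the positive coroots whose height is a multiple of K, because B
   consists of indecomposable roots for this subgroup. Pairings of roots with coroots being
   integers, the quotient is a half-integer. *)
Lemma height_half_integer a : a \in Phi -> a \in <<B>>%VS -> 2 * (ht a / K) \is a Num.int.
Proof.
move=> ha aB.
pose G : {pred 'rV[R]_l} := [pred v | (v \in <<B>>%VS) && (ht v / K \is a Num.int)].
have Gz : zmod_closed G.
  split=> [|u v]; first by rewrite inE mem0v ht0 mul0r rpred0.
  by rewrite !inE => /andP [hu iu] /andP [hv iv]; rewrite memvB // htB mulrBl rpredB.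
have Kle c : c \in pos_in Phi Delta G -> K <= ht c.
  move=> /pos_inP [/(pos_ht_gt0 rs ss) c0]; rewrite inE => /andP [_ /intrP [z ez]].
  have z0 : (0 < z)%R by rewrite -(ltr0z R) -ez divr_gt0.
  by rewrite -[K]mul1r -ler_pdivlMr // ez ler1z -gtz0_ge1.
have indB b : b \in B -> indecomposable Phi Delta G b.
  move=> bB; have [bpos eb] := hB bB; apply/andP; split.
    by rewrite mem_pos_in bpos inE memv_span // eb divff ?gt_eqF // rpred1.
  apply/allP => c /Kle hc; apply/negP => /Kle; rewrite htB eb; move: hc K0; lra.
have <- : half_coroot_sum Phi Delta G a = ht a / K.
  rewrite (coord_span (X := in_tuple B) aB) half_coroot_sum_sum ht_sum mulr_suml.
  apply: eq_bigr => i _; rewrite half_coroot_sumZ htZ.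
  have iB : (in_tuple B)`_i \in B by apply: mem_nth.
  have [_ ->] := hB iB.
  by rewrite (half_coroot_sum_indecomposable rs ss Gz (indB _ iB)) mulfK ?gt_eqF // mulr1.
rewrite /half_coroot_sum mulVKf ?pnatr_eq0 //; rewrite big_seq; apply: rpred_sum => c.
by move=> /pos_inP [/root_pos hc _]; apply: (root_crystallographic rs).
Qed.

Let low := [seq a <- Pos | (a \in <<B>>%VS) && (ht a < K)].

Let lowP a : a \in low -> [/\ a \in Pos, a \in <<B>>%VS & ht a = K / 2].
Proof.
rewrite mem_filter => /andP [/andP [aB aK] apos]; split=> //.
have := height_half_integer (root_pos apos) aB => /int_between0_2 h.
have /h : 0 < 2 * (ht a / K) by rewrite mulr_gt0 // divr_gt0 // (pos_ht_gt0 rs ss).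
have h2 : 2 * (ht a / K) < 2.
  by rewrite gtr_pMr // ltr_pdivrMr // mul1r.
move=> /(_ h2) e; have : ht a / K = 2^-1 by lra.
by move=> /(canRL (divfK (lt0r_neq0 K0))) ->; rewrite mulrC.
Qed.

Let split_roots := [seq b <- B | has (fun a => 0 < dot a b) low].

Let low_uniq : uniq low.
Proof. by rewrite filter_uniq // fset_uniq. Qed.

(** The low roots and the members of B that are not split form an obtuse, hence
   independent, set in the span of B. *)
Let size_low : (size low <= size split_roots)%N.
Proof.
pose rest := [seq b <- B | ~~ has (fun a => 0 < dot a b) low].
have restB b : b \in rest -> b \in B by rewrite mem_filter => /andP [].
have frest : free (low ++ rest).
  apply: (obtuse_free (Delta := Delta)).
  - rewrite cat_uniq low_uniq (filter_uniq _ uB) andbT /=.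
    apply/hasPn => b /restB /hB [_ eb]; apply/negP => /lowP [_ _]; rewrite eb.
    by move: K0; lra.
  - move=> a; rewrite mem_cat => /orP [/lowP [h _ _]|/restB /hB [h _]];
    exact: (pos_ht_gt0 rs ss).
  have cross a b : a \in low -> b \in rest -> dot a b <= 0.
    by move=> ha; rewrite mem_filter => /andP [/hasPn /(_ a ha)]; rewrite -leNgt.
  move=> a b; rewrite !mem_cat => /orP [ha|ha] /orP [hb|hb] ab.
  - have [/root_pos ? _ ea] := lowP ha; have [/root_pos ? _ eb] := lowP hb.
    by apply: (same_height_obtuse rs ss); rewrite ?ea ?eb.
  - exact: cross.
  - by rewrite dotC; apply: cross.
  have [/root_pos ? ea] := hB (restB _ ha); have [/root_pos ? eb] := hB (restB _ hb).
  by apply: (same_height_obtuse rs ss); rewrite ?ea ?eb.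
have : (size (low ++ rest) <= size B)%N.
  have /eqP <- := frest; apply: leq_trans (dim_span B); apply: dimvS.
  apply/span_subvP => a; rewrite mem_cat => /orP [/lowP [] //|/restB]; exact: memv_span.
rewrite size_cat -(count_predC (fun b => has (fun a => 0 < dot a b) low) B).
by rewrite /split_roots /rest !size_filter leq_add2r.
Qed.

Let split_rootP b : b \in split_roots -> exists a, [/\ a \in low, b - a \in low & a != b - a].
Proof.
rewrite mem_filter => /andP [/hasP [a alow dab] bB]; exists a.
have [apos aB ea] := lowP alow; have [bpos eb] := hB bB.
have aPhi := root_pos apos; have bPhi := root_pos bpos.
have ba : b != a by apply: contraTneq K0 => e; move: ea; rewrite -e eb; lra.
have dPhi : b - a \in Phi by apply: (root_sub rs) => //; rewrite dotC.
have dht : ht (b - a) = K / 2 by rewrite htB ea eb; lra.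
split=> //.
  have dpos : b - a \in Pos by apply: (pos_ht rs ss); rewrite // dht divr_gt0.
  have dB : b - a \in <<B>>%VS by rewrite memvB // memv_span.
  by rewrite mem_filter dpos dB dht andbT /=; move: K0; lra.
rewrite eq_sym subr_eq; apply: contraTneq bPhi => ->; exact: (root_ne2 rs).
Qed.

(** The angle of a and a' is obtuse as they have the same height; it is not right,
   for otherwise the reflection in a would send a + a' to a' - a, of height
   0. By integrality it is then at least 120 degrees. *)
Let cos_split a a' : a \in low -> a' \in low -> a + a' \in split_roots ->
  dot a a' / (Num.sqrt (dot a a) * Num.sqrt (dot a' a')) <= - 2^-1.
Proof.
move=> ha ha' hs; have [apos _ ea] := lowP ha; have [a'pos _ ea'] := lowP ha'.
have aPhi := root_pos apos; have a'Phi := root_pos a'pos.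
have sPhi : a + a' \in Phi by move: hs; rewrite mem_filter => /andP [_ /hB [/root_pos]].
have aa : 0 < dot a a by rewrite dot_gt0 (root_ne0 rs).
have aa' : 0 < dot a' a' by rewrite dot_gt0 (root_ne0 rs).
have d_neq0 : dot a a' != 0.
  apply/eqP => d0; have := root_refl rs aPhi sPhi.
  rewrite /reflection cartanD cartan_id ?(root_ne0 rs) // /cartan [dot a' a]dotC d0.
  rewrite mulr0 mul0r addr0 => /(root_ht0 rs ss).
  by rewrite htB htZ htD ea ea' => /eqP; apply; lra.
have neq : a != a' by apply: contraTneq sPhi => ->; apply: (root_ne2 rs).
have d_lt0 : dot a a' < 0.
  by rewrite lt_neqAle d_neq0 (same_height_obtuse rs ss) // ea ea'.
have cart_le b c : b \in Phi -> c \in Phi -> dot c b < 0 -> 0 < dot b b ->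
    2 * dot c b <= - dot b b.
  move=> hb hc d0 bb; have /intrP [z ez] := root_crystallographic rs hb hc.
  have cb : cartan c b * dot b b = 2 * dot c b by rewrite divfK ?gt_eqF.
  have z0 : (z < 0)%R by rewrite -(ltrz0 R) -ez; nra.
  have : cartan c b <= -1.
    by rewrite ez -[-1]/((-1)%:~R) ler_int -ltzD1 addNr.
  by nra.
have le1 := cart_le a' a a'Phi aPhi d_lt0 aa'.
have le2 : 2 * dot a a' <= - dot a a by rewrite dotC; apply: cart_le => //; rewrite dotC.
have N0 : 0 < Num.sqrt (dot a a) by rewrite sqrtr_gt0.
have N0' : 0 < Num.sqrt (dot a' a') by rewrite sqrtr_gt0.
rewrite ler_pdivrMr ?mulr_gt0 //.
have e1 : Num.sqrt (dot a a) ^+ 2 = dot a a by rewrite sqr_sqrtr // ltW.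
have e2 : Num.sqrt (dot a' a') ^+ 2 = dot a' a' by rewrite sqr_sqrtr // ltW.
suff : Num.sqrt (dot a a) * Num.sqrt (dot a' a') <= - (2 * dot a a') by lra.
have M0 : 0 <= Num.sqrt (dot a a) * Num.sqrt (dot a' a') by rewrite ltW // mulr_gt0.
have D0 : 0 <= - (2 * dot a a') by lra.
rewrite -(ler_pXn2r (n := 2)) ?nnegrE //.
by rewrite exprMn e1 e2 expr2 ler_pM ?dot_ge0 //; lra.
Qed.

(** All low roots have height K/2, and by size_low they are at most as many as the
   members of B that are sums of two of them. So the graph on the low roots
   with an edge for each such sum would have at least as many edges as
   vertices. As the scalar product of two adjacent unit vectors is at most -1/2 and no
   scalar product of distinct ones is positive, the sum v of all the unit vectors
   would have nonpositive square norm; but its height is positive. *)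
Lemma no_low_root_in_span a : a \in Pos -> a \in <<B>>%VS -> ~ ht a < K.
Proof.
move=> apos aB aK.
have alow : a \in low by rewrite mem_filter aB aK.
pose N (c : 'rV[R]_l) : R := Num.sqrt (dot c c).
have N0 c : c \in low -> 0 < N c.
  by move=> /lowP [/root_pos cPhi _ _]; rewrite sqrtr_gt0 dot_gt0 (root_ne0 rs).
pose v := \sum_(c <- low) (N c)^-1 *: c.
have v0 : v != 0.
  apply/eqP => v0; have : ht v = 0 by rewrite v0 ht0.
  rewrite ht_sum big_seq => /eqP; rewrite psumr_eq0 => [/allP /(_ a alow)|c clow]; rewrite htZ.
    by rewrite alow mulf_eq0 invr_eq0 !gt_eqF ?N0 ?(pos_ht_gt0 rs ss).
  have [/(pos_ht_gt0 rs ss) h _ _] := lowP clow.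
  by rewrite mulr_ge0 // ?invr_ge0 ltW // N0.
have pair c c' : c \in low -> c' \in low ->
    dot ((N c)^-1 *: c) ((N c')^-1 *: c')
    <= (c == c')%:R - 2^-1 * \sum_(b <- split_roots) (b == c + c')%:R.
  move=> hc hc'; have [/root_pos cPhi _ ec] := lowP hc.
  have [/root_pos cPhi' _ ec'] := lowP hc'.
  have -> : \sum_(b <- split_roots) (b == c + c')%:R = (c + c' \in split_roots)%:R :> R.
    rewrite -(count_uniq_mem _ (filter_uniq _ uB)) -sum1_count natr_sum [RHS]big_mkcond.
    by apply: eq_bigr => b _; rewrite /=; case: eqP.
  rewrite dotZl dotZr mulrA -invfM mulrC.
  have [ecc|ncc] := eqVneq c c'.
    rewrite -ecc -/(N c) -expr2 sqr_sqrtr ?dot_ge0 // divff ?dot_eq0 ?(root_ne0 rs) //.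
    rewrite (negPf (_ : c + c \notin split_roots)) ?mulr0 ?subr0 //.
    apply/negP; rewrite mem_filter => /andP [_ /hB [/root_pos h _]].
    by have := root_ne2 rs cPhi; rewrite h.
  rewrite sub0r; case: (boolP (_ \in split_roots)) => [hs|_].
    by rewrite mulr1 cos_split.
  rewrite mulr0 oppr0 pmulr_lle0 ?invr_gt0 ?mulr_gt0 ?N0 //.
  by apply: (same_height_obtuse rs ss); rewrite ?ec ?ec'.
have : 0 < dot v v by rewrite dot_gt0.
have : dot v v <= \sum_(c <- low) \sum_(c' <- low)
    ((c == c')%:R - 2^-1 * \sum_(b <- split_roots) (b == c + c')%:R).
  rewrite {1}/v dot_suml big_seq [X in _ <= X]big_seq; apply: ler_sum => c hc.
  rewrite dot_sumr big_seq [X in _ <= X]big_seq; apply: ler_sum => c' hc'.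
  exact: pair.
under eq_bigr do rewrite sumrB -mulr_sumr.
rewrite sumrB -mulr_sumr.
have -> : \sum_(c <- low) \sum_(c' <- low) (c == c')%:R = (size low)%:R :> R.
  rewrite -sum1_size natr_sum; apply: eq_big_seq => c hc.
  rewrite (bigD1_seq c) //= eqxx big1 ?addr0 // => c'; rewrite eq_sym => /negPf ->.
  by [].
have : (size split_roots)%:R * 2 <= \sum_(c <- low) \sum_(c' <- low)
     \sum_(b <- split_roots) (b == c + c')%:R :> R.
  under [X in _ <= X]eq_bigr do rewrite exchange_big.
  rewrite exchange_big /= -sum1_size natr_sum mulr_suml.
  rewrite big_seq [X in _ <= X]big_seq; apply: ler_sum => b hb.
  have [c [hc hbc cbc]] := split_rootP hb.
  have one d : b - d \in low -> 1 <= \sum_(c' <- low) (b == d + c')%:R :> R.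
    move=> hbd; rewrite (bigD1_seq (b - d)) //= [d + _]addrC subrK eqxx lerDl.
    by apply: sumr_ge0 => c' _; apply: ler0n.
  have hbc' : b - c \in [seq d <- low | d != c] by rewrite mem_filter eq_sym cbc.
  have ulow' : uniq [seq d <- low | d != c] by apply: filter_uniq.
  rewrite mul1r (bigD1_seq c) //= -[\sum_(d <- low | d != c) _]big_filter.
  rewrite (bigD1_seq (b - c) hbc' ulow') /=.
  have rest0 : 0 <= \sum_(d <- [seq d <- low | d != c] | d != b - c)
      \sum_(c' <- low) (b == d + c')%:R :> R.
    by apply: sumr_ge0 => d _; apply: sumr_ge0 => c' _; apply: ler0n.
  have := one c hbc; have := one (b - c); rewrite subKr => /(_ hc).
  by move: rest0; lra.
have : (size low)%:R <= (size split_roots)%:R :> R by rewrite ler_nat size_low.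
lra.
Qed.

End SameHeight.

(** * The induction on the height *)

Section Levels.
Variables (R : realType) (l : nat) (Phi : {fset 'rV[R]_l}) (Delta : l.-tuple 'rV[R]_l).
Variable (I : {fset 'rV[R]_l}).
Hypotheses (rs : root_system Phi) (ss : simple_system Phi Delta).
Hypothesis (hI : root_ideal Phi Delta I).
Implicit Types (a b v : 'rV[R]_l).
Local Notation Pos := (pos_roots Phi Delta).
Local Notation S := {mpoly R[l]}.

Lemma ideal_pos a : a \in I -> a \in Pos.
Proof. by case: hI => /fsubsetP sub _; apply: sub. Qed.

Lemma height_countE j : height_count Delta I j = size [seq a <- I | height Delta a == j].
Proof.
apply/perm_size/uniq_perm; rewrite ?fset_uniq ?filter_uniq ?fset_uniq // => a.
by rewrite !inE mem_filter andbC.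
Qed.

Lemma tangent_basis0 : tangent_basis [::] (fun i => delta_mx 0 i : 'rV[S]_l) (fun=> 0%N).
Proof.
split=> // [i j|w _|p p0 i].
- by rewrite mxE; case: (_ && _); rewrite ?dhomog1 ?rpred0.
- by exists (w 0); rewrite -row_sum_delta.
- have e : \row_i p i = 0.
    by rewrite -p0 [LHS]row_sum_delta; apply: eq_bigr => j _; rewrite mxE.
  by have /rowP /(_ i) := e; rewrite !mxE.
Qed.

(** The exponents are recorded by counting those that are at least j: an addition
   that raises some exponents from k to k + 1 only affects the count for
   j = k + 1. *)
Lemma tangent_basis_height k : exists th e,
  [/\ tangent_basis [seq a <- I | (height Delta a <= k)%N] th e,
      forall i : 'I_l, (e i <= k)%N
    & forall j, (0 < j <= k)%N -> #|[pred i | (j <= e i)%N]| = height_count Delta I j].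
Proof.
elim: k => [|k [th [e [bas ek cnt]]]].
  exists (fun i => delta_mx 0 i), (fun=> 0%N); split=> // [|[]//].
  apply: tangent_basis_ext tangent_basis0 => a; rewrite mem_filter; apply/esym/negP.
  by move=> /andP [h /ideal_pos /(height_gt0 rs ss)]; rewrite lt0n -leqn0 h.
set A := [seq a <- I | (height Delta a <= k)%N] in bas.
pose B := [seq a <- I | height Delta a == k.+1].
have uA : uniq A by rewrite filter_uniq // fset_uniq.
have uB : uniq B by rewrite filter_uniq // fset_uniq.
have AP a : a \in A -> a \in Pos /\ (height Delta a <= k)%N.
  by rewrite mem_filter => /andP [? /ideal_pos].
have BP b : b \in B -> b \in Pos /\ lin_height Delta b = k.+1%:R.
  by rewrite mem_filter => /andP [/eqP e1 /ideal_pos bpos]; rewrite -(heightE bpos) e1.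
have bNA b : b \in B -> b \notin A.
  by rewrite !mem_filter => /andP [/eqP -> _]; rewrite ltnn.
have [|x xB xA] := @generic_point _ _ B A.
  move=> a /AP [apos ak]; apply/negP => aB.
  apply: (no_low_root_in_span rs ss uB BP (ltr0Sn _ k) apos aB).
  by rewrite -(heightE apos) ltr_nat ltnS.
have freeB := same_height_free rs ss uB BP.
have redB b : b \in B -> reduced_seq (b :: A).
  move=> bB; apply: (pos_reduced rs ss); first by rewrite /= bNA.
  by move=> a; rewrite in_cons => /orP [/eqP ->|/AP []] //; have [] := BP b bB.
have degB b : b \in B -> (k <= restr_deg b A)%N.
  move=> bB; have [bpos hb] := BP b bB.
  have bk : height Delta b = k.+1 by apply/eqP; rewrite -(eqr_nat R) (heightE bpos) hb.
  have := @height_le_restr_deg _ _ _ _ rs ss A b bpos; rewrite bk; apply=> //.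
  - move=> a apos ab nc; rewrite mem_filter.
    have ba : b - a != 0 by rewrite subr_eq0 eq_sym.
    have := nat_comb_ht_ge1 ss nc ba; rewrite htB hb -(heightE apos) => h1.
    apply/andP; split; first by rewrite -(ler_nat R); move: h1; rewrite -natr1; lra.
    case: hI => _ h; apply: (h b a) => //.
    by move: bB; rewrite mem_filter => /andP [].
  - by move=> a /AP [].
  - exact: bNA.
have [th' [e' [bas' ek' cnt' top']]] :=
  multiple_addition bas ek redB freeB degB xB xA.
exists th', e'; split=> //.
  apply: tangent_basis_ext bas' => a; rewrite mem_cat !mem_filter -andb_orl.
  by rewrite [X in _ = X && _]leq_eqVlt ltnS.
move=> j /andP [j0]; rewrite leq_eqVlt ltnS => /orP [/eqP ->|jk].
  by rewrite top' height_countE.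
by rewrite cnt' // cnt // j0.
Qed.

Lemma max_height_leq a : a \in I -> (height Delta a <= max_height Delta I)%N.
Proof. by move=> aI; rewrite /max_height (big_rem a) //= leq_maxl. Qed.

End Levels.

(** * The dual partition *)

Lemma perm_dual_partition (R : realType) (l : nat) (Delta : l.-tuple 'rV[R]_l)
    (I : {fset 'rV[R]_l}) (e : 'I_l -> nat) :
  (forall i, (e i <= max_height Delta I)%N) ->
  (forall j, (0 < j)%N -> #|[pred i | (j <= e i)%N]| = height_count Delta I j) ->
  perm_eq [tuple e i | i < l] (dual_partition Delta I).
Proof.
move=> em cnt; set m := max_height Delta I in em *.
pose c j := #|[pred i | (j <= e i)%N]|.
have c0 : c 0%N = l by rewrite -[RHS]card_ord; apply: eq_card.
have ct x : count_mem x [tuple e i | i < l] = (c x - c x.+1)%N.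
  have -> : c x = (#|[pred i | e i == x]| + c x.+1)%N.
    rewrite -cardUI [X in (_ + X)%N]eq_card0 ?addn0 => [|i].
      by apply: eq_card => i; rewrite !inE leq_eqVlt eq_sym.
    by rewrite !inE; case: eqP => // ->; rewrite ltnn.
  rewrite addnK count_map cardE -size_filter /enum_mem; congr size.
  by rewrite -filter_predI; apply: eq_filter => i; rewrite /= inE andbT.
apply/allP => x _ /=; apply/eqP; rewrite ct /dual_partition count_cat count_nseq /=.
rewrite count_flatten -map_comp sumnE big_map.
under eq_bigr do rewrite /= count_nseq /=.
rewrite -!cnt // -/(c 1%N) -{1}c0.
have -> : (\sum_(j <- iota 1 m) (j == x) * (height_count Delta I j - height_count Delta I j.+1)
   = (0 < x) * (c x - c x.+1))%N.
  rewrite (eq_big_seq (fun j => (j == x) * (c x - c x.+1))%N); last first.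
    move=> j; rewrite mem_iota => /andP [j0 _]; rewrite -!cnt //.
    by case: eqP => [->|].
  rewrite -big_distrl /= -[X in (X * _)%N]/(\sum_(j <- _) _)%N.
  have [xm|xm] := boolP (x \in iota 1 m).
    rewrite (bigD1_seq x) ?iota_uniq //= eqxx big1 => [|j /negPf -> //].
    by move: xm; rewrite mem_iota => /andP [-> _].
  rewrite big_seq big1 ?mul0n => [|j jm]; last by case: eqP => // jx; rewrite -jx jm in xm.
  case: x xm => // x; rewrite mem_iota add1n ltnS -leqNgt => xm.
  rewrite mul1n; have -> : c x.+1 = 0%N; last by rewrite sub0n.
  by apply: eq_card0 => i; rewrite inE ltnNge (leq_trans (em i)).
by case: x => [|x]; rewrite /= ?mul1n ?mul0n ?addn0.
Qed.

(** * From coefficient vectors to derivations *)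

Section Translation.
Variables (R : realType) (l : nat).
Implicit Types (a b v : 'rV[R]_l) (I : {fset 'rV[R]_l}).
Local Notation S := {mpoly R[l]}.
Implicit Types (w : 'rV[S]_l) (f : S).

Lemma root_hyperplane_dim a : a != 0 -> (\dim (root_hyperplane a)).+1 = l.
Proof.
move=> a0; have aa : dot a a != 0 by rewrite dot_eq0.
have dis : (root_hyperplane a :&: <[a]> = 0)%VS.
  apply/eqP; rewrite -subv0; apply/subvP => v; rewrite memv_cap mem_root_hyperplane memv0.
  case/andP => va /vlineP [c ec]; move: va; rewrite ec dotZr mulf_eq0 (negPf aa) orbF.
  by move=> /eqP ->; rewrite scale0r.
have : (\dim (root_hyperplane a + <[a]>) = l)%N.
  suff -> : (root_hyperplane a + <[a]> = fullv)%VS by rewrite dimvf /dim /= mul1n.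
  apply/eqP; rewrite eqEsubv subvf; apply/subvP => v _.
  rewrite -(subrK ((dot a v / dot a a) *: a) v) memv_add ?memvZ ?memv_line //.
  by rewrite mem_root_hyperplane dotBr dotZr divfK // subrr.
by rewrite dimv_disjoint_sum // dim_vline a0 addn1.
Qed.

Lemma lform_defining a : defining_form (root_hyperplane a) (lform a).
Proof.
split=> [|v]; first exact: lform_homog.
by rewrite mem_root_hyperplane meval_lform.
Qed.

Lemma defining_form_lform a f : a != 0 -> defining_form (root_hyperplane a) f ->
  exists2 c : R, c != 0 & f = c *: lform a.
Proof.
move=> a0 [/homog1_lform ->]; move: (\row_i _) => b ker.
have {}ker v : (dot a v == 0) = (dot b v == 0).
  by rewrite -[dot b v]meval_lform -ker mem_root_hyperplane.
have aa : dot a a != 0 by rewrite dot_eq0.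
pose c := dot b a / dot a a; pose v := b - c *: a.
have va : dot a v = 0 by rewrite dotBr dotZr divfK // dotC subrr.
have vb : dot b v = 0 by apply/eqP; rewrite -ker va.
have eb : b = c *: a.
  apply/eqP; rewrite -subr_eq0 -/v -dot_eq0 {1}/v dotBl dotZl vb va mulr0 subr0 //.
exists c; last by rewrite eb linearZ.
by rewrite mulf_neq0 ?invr_eq0 // -ker.
Qed.

Definition deriv_of w f : S := \sum_i w 0 i * f^`M(i).

Lemma deriv_of_derivation w : derivation (deriv_of w).
Proof.
split=> [c f g|f g]; rewrite /deriv_of.
  rewrite scaler_sumr -big_split; apply: eq_bigr => i _ /=.
  by rewrite mderivD mderivZ mulrDr scalerAr.
rewrite mulr_suml mulr_sumr -big_split; apply: eq_bigr => i _ /=.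
by rewrite mderivM; ring.
Qed.

Lemma deriv_ofX w i : deriv_of w 'X_i = w 0 i.
Proof.
rewrite /deriv_of (bigD1 i) //= mderivX mnm1E eqxx scale1r.
rewrite [X in 'X_[X]](_ : _ = 0%MM) ?mpolyX0 ?mulr1; last first.
  by apply/mnmP => j; rewrite mnmBE mnm0E subnn.
by rewrite big1 ?addr0 // => j ji; rewrite mderivX mnm1E eq_sym (negPf ji) scale0r mulr0.
Qed.

Lemma derivation_lform (theta : S -> S) a : derivation theta ->
  theta (lform a) = along (\row_i theta 'X_i) a.
Proof.
move=> [lin _].
pose th := HB.pack_for {linear S -> S} theta (GRing.isLinear.Build R S S _ theta lin).
rewrite -[theta]/(th : S -> S) /lform linear_sum; apply: eq_bigr => i _.
by rewrite linearZ mxE.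
Qed.

Lemma deriv_of_lform w a : deriv_of w (lform a) = along w a.
Proof.
rewrite (derivation_lform _ (deriv_of_derivation w)); congr along.
by apply/rowP => i; rewrite mxE deriv_ofX.
Qed.

Lemma derivation_deriv_of (theta : S -> S) f : derivation theta ->
  theta f = deriv_of (\row_i theta 'X_i) f.
Proof.
move=> [lin leib]; set w := \row_i _; have [lin' leib'] := deriv_of_derivation w.
pose ok f := theta f = deriv_of w f.
have ok1 (eta : S -> S) : derivation eta -> eta 1 = 0.
  move=> [_ lb]; have := lb 1 1; rewrite !mulr1 mul1r => /eqP.
  by rewrite -subr_eq subrr eq_sym => /eqP.
have okM g h : ok g -> ok h -> ok (g * h).
  by rewrite /ok leib leib' => -> ->.
have okX m : ok 'X_[m].
  rewrite mpolyXE_id; elim/big_rec: _ => [|i g _ okg].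
    by rewrite /ok !ok1 //; apply: deriv_of_derivation.
  apply: (okM _ _ _ okg); elim: (m i) => [|n IHn].
    by rewrite /ok !ok1 //; apply: deriv_of_derivation.
  by rewrite exprS; apply: (okM _ _ _ IHn); rewrite /ok deriv_ofX mxE.
rewrite -/(ok f); elim/mpolyind: f => [|c m p _ _ IHp].
  have z (eta : S -> S) : linear eta -> eta 0 = 0.
    by move=> ln; have := ln (-1) 0 0; rewrite scaler0 addr0 scaleN1r addNr.
  by rewrite /ok !z.
by rewrite /ok lin lin' okX IHp.
Qed.

Lemma log_derivationP I (theta : S -> S) : {in I, forall a, a != 0} -> derivation theta ->
  log_derivation (ideal_arrangement I) theta <-> tangent I (\row_i theta 'X_i).
Proof.
move=> I0 der; split=> [[_ h] a aI|tg].
  rewrite -derivation_lform //; apply: h (lform_defining a).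
  exact: in_imfset.
split=> // H /imfsetP [a /= aI ->] f /(defining_form_lform (I0 a aI)) [c c0 ->].
have [g eg] := tg a aI; exists g.
have [lin _] := der.
have -> : theta (c *: lform a) = c *: theta (lform a).
  have z : theta 0 = 0.
    by have := lin (-1) 0 0; rewrite scaler0 addr0 scaleN1r addNr.
  by have := lin c (lform a) 0; rewrite z !addr0.
by rewrite derivation_lform // eg scalerAl.
Qed.

Lemma tangent_basis_free I th e : {in I, forall a, a != 0} -> tangent_basis I th e ->
  free_with_exponents (ideal_arrangement I) [tuple e i | i < l].
Proof.
move=> I0 [tg hom gen free].
exists (fun i => deriv_of (th i)), [tuple e i | i < l]; split=> //; last first.
  by move=> i f /homog1_lform ->; rewrite deriv_of_lform tnth_mktuple; apply: along_homog.
split.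
- move=> i; apply/log_derivationP => //; first exact: deriv_of_derivation.
  by rewrite (_ : \row_j _ = th i) //; apply/rowP => j; rewrite mxE deriv_ofX.
- move=> eta logeta; have [der _] := logeta.
  have /(log_derivationP I0 der) /gen [p ep] := logeta.
  exists p => f; rewrite (derivation_deriv_of f der) ep /deriv_of.
  under [RHS]eq_bigr do rewrite mulr_sumr.
  rewrite [RHS]exchange_big; apply: eq_bigr => j _.
  by rewrite summxE mulr_suml; apply: eq_bigr => i _; rewrite mxE mulrA.
move=> p p0; apply: free; apply/rowP => j; rewrite summxE mxE -[RHS](p0 'X_j).
by apply: eq_bigr => i _; rewrite mxE deriv_ofX.
Qed.

End Translation.

(** * The theorem *)

Theorem theorem1p1 (R : realType) (l : nat) (Phi : {fset 'rV[R]_l})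
    (Delta : l.-tuple 'rV[R]_l) (I : {fset 'rV[R]_l}) :
  root_system Phi ->
  irreducible_roots Phi ->
  simple_system Phi Delta ->
  root_ideal Phi Delta I ->
  [/\ height_count_nonincreasing Delta I,
      is_arrangement (ideal_arrangement I)
    & free_with_exponents (ideal_arrangement I) (dual_partition Delta I)].
Proof.
move=> rs _ ss hI.
have I0 : {in I, forall a, a != 0}.
  by move=> a /(ideal_pos hI) /root_pos; apply: (root_ne0 rs).
have [th [e [bas em cnt]]] := tangent_basis_height rs ss hI (max_height Delta I).
have {}cnt j : (0 < j)%N -> #|[pred i | (j <= e i)%N]| = height_count Delta I j.
  move=> j0; have [jm|mj] := leqP j (max_height Delta I); first by rewrite cnt // j0.
  rewrite eq_card0 => [|i]; last by rewrite inE leqNgt (leq_ltn_trans (em i)).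
  rewrite height_countE; apply/esym/eqP; rewrite size_eq0 -[_ == _]negbK -has_filter.
  apply/hasPn => a /(max_height_leq Delta) am.
  by apply: contraTneq am => ->; rewrite -ltnNge.
split.
- split=> [|j /andP [j0 _]]; rewrite -!cnt //.
    by rewrite -[X in (_ <= X)%N]card_ord max_card.
  by apply/subset_leq_card/subsetP => i; rewrite !inE; apply: ltnW.
- move=> H /imfsetP [a /= aI ->]; exact: root_hyperplane_dim (I0 a aI).
have {}bas : tangent_basis I th e.
  apply: tangent_basis_ext bas => a; rewrite mem_filter andb_idl //.
  exact: max_height_leq.
have [theta [d [basis hom pd]]] := tangent_basis_free I0 bas.
exists theta, d; split=> //; apply: perm_trans pd _.
exact: perm_dual_partition.
Qed.
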